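(* Let $H_1=\begin{bmatrix} f_1&u_1\\ g_1&v_1\end{bmatrix}$ and $H_2=\begin{bmatrix} f_2&u_2\\ g_2&v_2\end{bmatrix}$ be $2\times 2$ matrices with entries in $L^\infty$. Then $R_{H_1}R_{H_2}=R_{H_2}R_{H_1}$ if and only if the following three operator equations all hold: $$H_{\bar u_2}T_{\bar f_1}+\tilde T_{\bar v_2}H_{\bar u_1}-H_{\bar u_1}T_{\bar f_2}-\tilde T_{\bar v_1}H_{\bar u_2}=0;$$ $$H_{g_1}T_{f_2}+\tilde T_{v_1}H_{g_2}-H_{g_2}T_{f_1}-\tilde T_{v_2}H_{g_1}=0;$$ $$\begin{bmatrix} V(\bar f_1)_-\\ (g_1)_-\end{bmatrix}\otimes\begin{bmatrix} V(f_2)_-\\ (\bar u_2)_-\end{bmatrix}-\begin{bmatrix} V(\bar u_1)_-\\ (v_1)_-\end{bmatrix}\otimes\begin{bmatrix} V(g_2)_-\\ (\bar v_2)_-\end{bmatrix}=\begin{bmatrix} V(\bar f_2)_-\\ (g_2)_-\end{bmatrix}\otimes\begin{bmatrix} V(f_1)_-\\ (\bar u_1)_-\end{bmatrix}-\begin{bmatrix} V(\bar u_2)_-\\ (v_2)_-\end{bmatrix}\otimes\begin{bmatrix} V(g_1)_-\\ (\bar v_1)_-\end{bmatrix}.$$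
   Context: $L^2$ and $L^\infty$ are the Lebesgue spaces of the unit circle $\mathbb T$ with normalized Lebesgue measure. $H^2\subset L^2$ is the Hardy space (functions whose negative Fourier coefficients vanish), $P_+$ is the orthogonal projection of $L^2$ onto $H^2$, $P_-=I-P_+$, and $(H^2)^\perp=L^2\ominus H^2=\bar z\overline{H^2}$. A bar on a function denotes complex conjugation. For $x\in L^2$, $x_-=P_-x$. $V$ is the anti-unitary operator on $L^2$ given by $Vx=\bar z\bar x$; $V(x)_-$ means $V(P_-x)$. For vectors $p,q$ in a Hilbert space, $p\otimes q$ is the operator $x\mapsto\langle x,q\rangle p$; columns $\begin{bmatrix} x\\ y\end{bmatrix}$ with $x,y\in L^2$ are vectors of $L^2\oplus L^2$. For $\phi\in L^\infty$: the Toeplitz operator $T_\phi:H^2\to H^2$, $T_\phi x=P_+(\phi x)$; the Hankel operator $H_\phi:H^2\to(H^2)^\perp$, $H_\phi x=P_-(\phi x)$; the dual Toeplitz operator $\tilde T_\phi:(H^2)^\perp\to(H^2)^\perp$, $\tilde T_\phi y=P_-(\phi y)$. For $H=\begin{bmatrix} f&u\\ g&v\end{bmatrix}$ with entries in $L^\infty$, the generalized Cauchy singular integral operator with symbol $H$ is the operator on $L^2$ given by $R_Hx=P_+fP_+x+P_-gP_+x+P_+uP_-x+P_-vP_-x$. *)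

(* Defs.v *)
From HB Require Import structures.
From mathcomp Require Import all_boot all_order all_algebra.
From mathcomp Require Import all_classical all_reals all_analysis.
From mathcomp Require Export complex.

Set Implicit Arguments.
Unset Strict Implicit.
Unset Printing Implicit Defensive.
Import Order.TTheory GRing.Theory Num.Theory.
Import numFieldNormedType.Exports.
Local Open Scope classical_set_scope.
Local Open Scope ring_scope.
Local Open Scope complex_scope.

(* The unit circle is parametrized by the angle t in [0, 2 pi], z = e^(it).
   The normalized Lebesgue measure is dt / (2 pi) on [0, 2 pi]; as a measure on
   the real line it gives mass 0 to the complement of [0, 2 pi]. *)
Lemma twopi_gt0 (R : realType) : 0 < 2 * pi :> R.
Proof. by rewrite mulr_gt0 ?ltr0n ?pi_gt0. Qed.

Definition circle_measure (R : realType)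
    : {measure set (measurableTypeR R) -> \bar R} :=
  uniform_prob (twopi_gt0 R).

(* Elements of L^2 and L^oo are represented by functions of the angle; all
   equalities between them are stated almost everywhere. *)
Definition cfun (R : realType) : Type := measurableTypeR R -> R[i].

Definition zfun (R : realType) : cfun R := fun t => cos t +i* sin t.

Definition conjf (R : realType) (f : cfun R) : cfun R := fun t => (f t)^*.

Section LebesgueSpaces.
Context {R : realType}.
Local Notation mu := (circle_measure R).
Implicit Types (f x y : cfun R) (p : \bar R).

Definition cLp p : set (cfun R) :=
  [set f : cfun R | [/\ measurable_fun setT (fun t => complex.Re (f t)),
               measurable_fun setT (fun t => complex.Im (f t)) &
               finite_norm mu p (fun t => ComplexField.Normc.normc (f t))]].

Definition L2 : set (cfun R) := cLp 2%:E.
Definition Linfty : set (cfun R) := cLp +oo%E.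

Definition cint f : R[i] :=
  (\int[mu]_t complex.Re (f t)) +i* (\int[mu]_t complex.Im (f t)).

Definition inner x y : R[i] := cint (x \* conjf y).

Definition fourier x (k : int) : R[i] := inner x (fun t => zfun t ^ k).

Definition hardy : set (cfun R) :=
  [set x | L2 x /\ forall k : int, k < 0 -> fourier x k = 0].

(* The orthogonal projection onto H^2: on x in L^2, a (representative of the)
   y in H^2 such that x - y is orthogonal to H^2.  Outside L^2 the value is
   irrelevant. *)
Definition Pplus x : cfun R :=
  xget (fun=> 0)
    [set y | hardy y /\ forall h, hardy h -> inner (x \- y) h = 0].

Definition Pminus x : cfun R := x \- Pplus x.

Definition antiV x : cfun R := conjf (@zfun R) \* conjf x.

(* The domains of the next three operators are H^2, H^2 and its orthogonal
   complement; they are given as total maps, and their domains appear in the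
   equalities between operators. *)
Definition Toeplitz f : cfun R -> cfun R := fun x => Pplus (f \* x).
Definition Hankel f : cfun R -> cfun R := fun x => Pminus (f \* x).
Definition dualToeplitz f : cfun R -> cfun R := fun y => Pminus (f \* y).

Definition Cauchy_op (H : 'M[cfun R]_2) : cfun R -> cfun R := fun x =>
  Pplus (H 0 0 \* Pplus x) \+ Pminus (H 1 0 \* Pplus x)
  \+ Pplus (H 0 1 \* Pminus x) \+ Pminus (H 1 1 \* Pminus x).

Definition eq_operator (D : set (cfun R)) (A B : cfun R -> cfun R) : Prop :=
  forall x, D x -> A x = B x %[ae mu].

Definition inner2 (x y : cfun R * cfun R) : R[i] :=
  inner x.1 y.1 + inner x.2 y.2.

Definition tensor2 (p q : cfun R * cfun R) (x : cfun R * cfun R)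
    : cfun R * cfun R :=
  (inner2 x q \*o p.1, inner2 x q \*o p.2).

Definition eq_operator2 (A B : cfun R * cfun R -> cfun R * cfun R) : Prop :=
  forall x : cfun R * cfun R, L2 x.1 -> L2 x.2 ->
    (A x).1 = (B x).1 %[ae mu] /\ (A x).2 = (B x).2 %[ae mu].

End LebesgueSpaces.

(* Main.v *)
Require Import Defs.
From HB Require Import structures.
From mathcomp Require Import all_boot all_order all_algebra.
From mathcomp Require Import all_classical all_reals all_analysis.
From mathcomp Require Import measurable_realfun ess_sup_inf.
From mathcomp Require Import ring lra zify.

Set Implicit Arguments.
Unset Strict Implicit.
Unset Printing Implicit Defensive.
Import Order.TTheory GRing.Theory Num.Theory.
Import numFieldNormedType.Exports.
Local Open Scope classical_set_scope.
Local Open Scope ring_scope.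

(** Along the decomposition of [L^2] into [H^2] and its orthogonal complement, the
    operator [R_H] is a 2 x 2 block operator: its diagonal entries are the Toeplitz
    operator of [f] and the dual Toeplitz operator of [v], its off-diagonal entries
    are the Hankel operator of [g] and the adjoint of the Hankel operator of
    [conj u]. So [R_(H1)] and [R_(H2)] commute iff four identities between blocks
    hold ([Cauchy_commute_blocks]).

    The two off-diagonal identities are the first two operator equations, one of
    them after taking adjoints ([Hankel_equation_block], [block_conj]).

    For the diagonal identities, a product of two Toeplitz operators is the Toeplitz
    operator of the product of the symbols minus a product of Hankel operators; the
    first part is symmetric in the factors and cancels. What remains on [H^2] is the
    vanishing of an alternating sum [D] of four forms [<H_f a, H_g b>]
    ([block_diag_hardy]). The anti-unitary [V] exchanges [H^2] with its complement
    and brings the other diagonal block to the same shape ([block_diag_hperp]).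
    Since [P_- (z w)] and [z P_- w] differ by the constant [<w, conj z>], each form
    changes under the shift by a rank-one term:
    [<H_f a, H_g b> - <H_f (z a), H_g (z b)> = <a, V f_-> conj <b, V g_->]
    ([hform_shift]). Hence the diagonal entries of the tensor equation express that
    [D] is invariant under the shift. If [D = 0] this is clear; conversely
    invariance gives [D (a, b) = D (z^n a, z^n b)], which tends to 0 because
    [P_- (z^n w)] tends to 0 in norm ([hform4_coefV]). The same shift computation
    on the off-diagonal blocks shows that the off-diagonal entries of the tensor
    equation already follow from the first two operator equations
    ([block_offdiag]).

    Functions are only given up to null sets, so identities are tested against inner
    products with square-integrable functions ([innerP]). The existence of the
    projection onto [H^2] comes from the Riesz-Fischer theorem ([L2_complete])
    applied to partial Fourier sums. That [V] exchanges [H^2] and its complement, and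
    that [P_- (z^n w)] tends to 0, rest on the uniqueness of Fourier coefficients
    ([fourier_eq0]). It is proved as follows: the bounded real functions that
    preserve the vanishing of all Fourier coefficients form an algebra that contains
    [cos] and [sin] and is closed under bounded pointwise limits, so it contains the
    indicator of every Borel set [A], and a function without Fourier coefficients
    has integral 0 over [A]. *)

(** * Completeness of L^2 of a finite measure *)

Section RieszFischer.
Context d (T : measurableType d) (R : realType).
Variable mu : {finite_measure set T -> \bar R}.

(** By monotone convergence the sum of the [|w n|] has a finite integral, so it
    is finite almost everywhere, and absolute convergence gives convergence. *)
Lemma sum_integrable_ae_cvg (w : nat -> T -> R) :
  (forall n, measurable_fun setT (w n)) ->
  (\sum_(n <oo) \int[mu]_t `|w n t|%:E < +oo)%E ->
  exists A : set T, [/\ measurable A, mu (~` A) = 0 &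
    forall t, A t -> cvgn (series (fun n => w n t))].
Proof.
move=> mw sw.
pose g t := (\sum_(n <oo) `|w n t|%:E)%E.
have ew n : measurable_fun [set: T] (EFin \o (fun t => `|w n t|)).
  by apply/measurable_EFinP; exact: measurableT_comp.
have ig : (\int[mu]_t g t < +oo)%E.
  by rewrite integral_nneseries// => n; exact/measurable_EFinP.
have mg : measurable_fun setT g.
  by apply: ge0_emeasurable_sum => // n _; exact: ew.
have g0 t : (0 <= g t)%E by exact: nneseries_ge0.
have intg : mu.-integrable setT g.
  by apply/integrableP; split => //; under eq_integral do rewrite gee0_abs//.
exists (g @^-1` [set x | x \is a fin_num]); split.
- rewrite -[X in measurable X]setTI; apply: emeasurable_fin_num => //.
- have := integrable_ae measurableT intg.
  move=> [N [mN N0 subN]]; apply/eqP; rewrite -measure_le0 -N0.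
  apply: le_measure; rewrite ?inE//.
    apply: measurableC; rewrite -[X in measurable X]setTI.
    exact: emeasurable_fin_num.
  by move=> t /= gt; apply: subN => /= /(_ I).
- move=> t /= gt; apply: normed_cvg.
  have hl : (fun n => \sum_(0 <= k < n) (`|w k t|)%:E)%E @ \oo --> g t.
    by apply: is_cvg_nneseries => n _ _; rewrite lee_fin.
  rewrite -(fineK gt) in hl.
  apply/cvg_ex; exists (fine (g t)).
  move/fine_cvgP : hl => [_ hl].
  apply: cvg_trans hl; apply: near_eq_cvg; near=> n.
  by rewrite /= sumEFin.
Unshelve. all: by end_near. Qed.

(** Controls a first moment by a second moment with a free weight; this replaces
    the inequality of Hoelder in the estimates below. *)
Lemma normr_le_sqr_weight (a x : R) : 0 < a -> `|x| <= a * x ^+ 2 + a^-1.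
Proof.
move=> a0; rewrite -(ler_pM2l a0) mulrDr divff ?gt_eqF// -real_normK ?num_real//.
have -> : a * (a * `|x| ^+ 2) + 1 = a * `|x| + ((a * `|x| - 2^-1) ^+ 2 + 3 / 4).
  by field.
by rewrite lerDl addr_ge0 ?sqr_ge0.
Qed.

Lemma limn_einf_le (u : nat -> \bar R) (l : \bar R) N :
  (forall n, (N <= n)%N -> (u n <= l)%E) -> (limn_einf u <= l)%E.
Proof.
move=> ul; rewrite limn_einf_lim; apply: lime_le; first exact: is_cvg_einfs.
apply: nearW => n; apply: (@le_trans _ _ (u (maxn n N))).
  by apply: ereal_inf_lbound; exists (maxn n N) => //=; exact: leq_maxl.
by apply: ul; exact: leq_maxr.
Qed.

(** Riesz-Fischer. Along a subsequence [v] with increments of squared norm at most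
    [4^-j] the increments are summable almost everywhere, which produces the limit.
    The lemma of Fatou then carries the Cauchy estimate over to the limit, for the
    whole sequence. *)
Lemma L2_complete (u : nat -> T -> R) :
  (forall n, measurable_fun setT (u n)) ->
  (forall e : R, 0 < e -> exists N, forall m n, (N <= m)%N -> (N <= n)%N ->
     (\int[mu]_t ((u m t - u n t) ^+ 2)%:E <= e%:E)%E) ->
  exists2 y : T -> R, measurable_fun setT y &
    forall e : R, 0 < e -> exists N, forall n, (N <= n)%N ->
      (\int[mu]_t ((u n t - y t) ^+ 2)%:E <= e%:E)%E.
Proof.
move=> mu_ cu.
have e0 (j : nat) : 0 < (4^-1 : R) ^+ j by rewrite exprn_gt0.
have /choice [N hN] := fun j => cu _ (e0 j).
(* The summand [j] makes the indices tend to infinity, which Fatou needs. *)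
pose s j := (j + \sum_(i < j.+1) N i)%N.
have Ns j : (N j <= s j)%N by rewrite /s big_ord_recr/= addnA leq_addl.
have sS j : (s j <= s j.+1)%N.
  by rewrite /s [in leqRHS]big_ord_recr/= leq_add// leq_addr.
pose v j := u (s j); pose w j t := v j.+1 t - v j t.
have mw n : measurable_fun setT (w n) by apply: measurable_funB; exact: mu_.
pose K := 1 + fine (mu setT).
have K0 : 0 <= K by rewrite addr_ge0 ?fine_ge0.
have iw j : (\int[mu]_t (`|w j t|)%:E <= (K * (2^-1) ^+ j)%:E)%E.
  have p0 : 0 < (2 : R) ^+ j by rewrite exprn_gt0.
  apply: (@le_trans _ _
    (\int[mu]_t ((2 ^+ j)%:E * ((w j t) ^+ 2)%:E + ((2^-1) ^+ j)%:E)%E)%E).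
    apply: ge0_le_integral => //.
    - by apply/measurable_EFinP; exact: measurableT_comp.
    - apply: emeasurable_funD => //; apply: emeasurable_funM => //.
      by apply/measurable_EFinP; exact: measurable_funX.
    - by move=> t _; rewrite -EFinM -EFinD lee_fin exprVn normr_le_sqr_weight.
  rewrite ge0_integralD//; last 2 first.
    - by move=> t _; rewrite -EFinM lee_fin mulr_ge0 ?sqr_ge0// ltW.
    - apply: emeasurable_funM => //.
      by apply/measurable_EFinP; exact: measurable_funX.
  rewrite ge0_integralZl//; last 2 first.
    - by apply/measurable_EFinP; exact: measurable_funX.
    - by move=> t _; rewrite lee_fin sqr_ge0.
  rewrite integral_cst// mulrDl mul1r EFinD; apply: leeD.
    apply: (@le_trans _ _ ((2 ^+ j)%:E * ((4^-1) ^+ j)%:E)%E).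
      apply: lee_wpmul2l; first by rewrite lee_fin ltW.
      by apply: hN => //; exact: leq_trans (sS j).
    rewrite -EFinM lee_fin -exprMn (_ : 2 * 4^-1 = 2^-1 :> R)//.
    by field.
  by rewrite mulrC EFinM fineK// fin_num_measure.
have [|A [mA A0 cA]] := sum_integrable_ae_cvg mw.
  apply: (@le_lt_trans _ _ (K * 2)%:E); last by rewrite ltry.
  apply: lime_le.
    by apply: is_cvg_nneseries => n _ _; exact: integral_ge0.
  apply: nearW => n.
  apply: (@le_trans _ _ (\sum_(0 <= j < n) (K * (2^-1) ^+ j)%:E)%E).
    by apply: lee_sum.
  rewrite sumEFin lee_fin -mulr_sumr ler_wpM2l//.
  suff -> : \sum_(0 <= j < n) (2^-1 : R) ^+ j = 2 - 2 * 2^-1 ^+ n.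
    by rewrite lerBlDr lerDl mulr_ge0// exprn_ge0.
  elim: n => [|n IH]; first by rewrite big_geq// expr0 mulr1 subrr.
  by rewrite big_nat_recr//= IH exprS; field.
have cv t : A t -> cvgn (v ^~ t).
  move=> /cA cw; have -> : v ^~ t = (fun n => v 0%N t + series (fun n => w n t) n).
    by apply/funext => n; rewrite [LHS](@eq_sum_telescope _ (v ^~ t)).
  by apply: is_cvgD => //; exact: is_cvg_cst.
(* Off [A] the sequence is replaced by 0, so that the limit exists everywhere and
   is measurable. *)
pose y t := limn (fun j => v j t * \1_A t).
have cy t : (fun j => v j t * \1_A t) @ \oo --> y t.
  rewrite /y indicE; case: (boolP (t \in A)) => [|_].
    by rewrite inE => At; under eq_fun do rewrite mulr1; exact: cv.
  by under eq_fun do rewrite mulr0; exact: is_cvg_cst.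
have my : measurable_fun setT y.
  apply: (@measurable_fun_cvg _ _ _ setT (fun j t => v j t * \1_A t)) => // m.
  by apply: measurable_funM; [exact: mu_|exact: measurable_indic].
exists y => // e ep; have [N0 hN0] := cu _ ep; exists N0 => n N0n.
pose g m t := ((u n t - v m t) ^+ 2)%:E.
have mg m : measurable_fun setT (g m).
  by apply/measurable_EFinP/measurable_funX; apply: measurable_funB; exact: mu_.
have g0 m t : (0 <= g m t)%E by rewrite lee_fin sqr_ge0.
rewrite (_ : (\int[mu]_t _ = \int[mu]_t limn_einf (g ^~ t))%E); last first.
  apply: ge0_ae_eq_integral => //.
  - by apply/measurable_EFinP/measurable_funX; apply: measurable_funB => //; exact: mu_.
  - under eq_fun do rewrite -[limn_einf _]oppeK -limn_esupN.
    apply: measurableT_comp => //; apply: measurable_fun_limn_esup => m.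
    exact: measurableT_comp.
  - by move=> t _; rewrite lee_fin sqr_ge0.
  - move=> t _; rewrite limn_einf_lim; apply: lime_ge; first exact: is_cvg_einfs.
    by apply: nearW => m; apply: le_ereal_inf_tmp => _ [p _ <-]; exact: g0.
  exists (~` A); split => //; first exact: measurableC.
  move=> t /= + At; apply => _.
  have cg : g ^~ t @ \oo --> ((u n t - y t) ^+ 2)%:E.
    apply/fine_cvgP; split; first exact: nearW.
    have -> : fine \o g ^~ t = (fun m => (u n t - v m t * \1_A t) ^+ 2).
      by apply/funext => m; rewrite /= indicE mem_set// mulr1.
    rewrite expr2; under eq_fun do rewrite expr2.
    by apply: cvgM; apply: cvgB => //; exact: cvg_cst.
  by rewrite (cvg_limn_einf_sup cg).1.
apply: (le_trans (fatou mu measurableT mg _)) => //.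
apply: (@limn_einf_le _ _ N0) => m N0m; apply: hN0 => //.
apply: (leq_trans N0m); exact: leq_addr.
Qed.

End RieszFischer.

(** * Polynomial approximation of a step *)

Section StepPolynomials.
Context {R : realType}.
Implicit Types (r s w : R) (n : nat).

Lemma bernoulli_ineq (a : R) n : -1 <= a -> 1 + n%:R * a <= (1 + a) ^+ n.
Proof.
move=> a1; elim: n => [|n IH]; first by rewrite mul0r addr0 expr0.
have h : 0 <= 1 + a by rewrite -lerBlDl sub0r.
rewrite exprS; apply: le_trans (ler_wpM2l h IH); rewrite -subr_ge0.
rewrite -natr1 (_ : _ - _ = n%:R * a ^+ 2); last by ring.
by rewrite mulr_ge0 ?sqr_ge0.
Qed.

(** Bounds [n s^n] by [1 / (1 - s)]; with [r = s^2] it follows that [n r^n] tends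
    to 0. *)
Lemma natmul_expr_le s n : 0 <= s <= 1 -> n%:R * s ^+ n * (1 - s) + s ^+ n <= 1.
Proof.
move=> /andP[s0 s1]; elim: n => [|n IH]; first by rewrite !mul0r add0r expr0.
have -> : n.+1%:R * s ^+ n.+1 * (1 - s) + s ^+ n.+1 =
    s * (n%:R * s ^+ n * (1 - s) + s ^+ n) + s ^+ n.+1 * (1 - s).
  by rewrite -natr1 exprS; ring.
apply: (@le_trans _ _ (s * 1 + 1 * (1 - s))); last by rewrite mulr1 mul1r subrKC.
apply: lerD; first exact: ler_wpM2l.
by rewrite ler_wpM2r ?subr_ge0// exprn_ile1.
Qed.

Lemma cvg_natmul_expr r : 0 <= r -> r < 1 -> n%:R * r ^+ n @[n --> \oo] --> (0 : R).
Proof.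
move=> r0 r1; pose s := Num.sqrt r.
have s0 : 0 <= s by exact: sqrtr_ge0.
have s1 : s < 1 by rewrite -[ltRHS]sqrtr1 ltr_sqrt.
have rs : r = s ^+ 2 by rewrite sqr_sqrtr.
have d0 : 0 < 1 - s by rewrite subr_gt0.
apply: (@squeeze_cvgr _ _ _ _ (fun=> 0) (fun n => (1 - s)^-1 * s ^+ n)).
- apply: nearW => n; rewrite mulr_ge0 ?exprn_ge0//=.
  rewrite rs -exprM mulnC exprM expr2 mulrA ler_wpM2r ?exprn_ge0//.
  rewrite -[leRHS]mul1r ler_pdivlMr//.
  apply: le_trans (@natmul_expr_le s n _); last by rewrite s0 ltW.
  by rewrite lerDl exprn_ge0.
- exact: cvg_cst.
- rewrite -(mulr0 (1 - s)^-1); apply: cvgM; first exact: cvg_cst.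
  by apply: cvg_expr; rewrite ger0_norm.
Qed.

(** On [[0, 1]] these polynomials in [w] converge to the indicator of [[0, 1/2[].
    The exponent [2^n] alone would do so off the threshold; the factor [n] forces
    the limit 0 at [w = 1/2] as well. *)
Definition step_poly n w := (1 - w ^+ n) ^+ (n * 2 ^ n).

Lemma step_poly_itv n w : 0 <= w <= 1 -> 0 <= step_poly n w <= 1.
Proof.
move=> /andP[w0 w1]; have h : 0 <= 1 - w ^+ n <= 1.
  by rewrite subr_ge0 exprn_ile1//= lerBlDr lerDl exprn_ge0.
by case/andP: h => h0 h1; rewrite exprn_ge0//= exprn_ile1.
Qed.

(** By Bernoulli, [1 - n (2w)^n <= step_poly n w <= 1]. *)
Lemma step_poly_cvg1 w : 0 <= w < 2^-1 -> step_poly ^~ w @ \oo --> (1 : R).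
Proof.
move=> /andP[w0 w1]; have w1' : w <= 1 by lra.
apply: (@squeeze_cvgr _ _ _ _ (fun n => 1 - n%:R * (2 * w) ^+ n) (fun=> 1)).
- apply: nearW => n /=.
  have /andP[_ ->] : 0 <= step_poly n w <= 1 by apply: step_poly_itv; rewrite w0.
  rewrite andbT /step_poly exprMn mulrA -natrX -natrM -mulrN.
  by apply: bernoulli_ineq; rewrite lerN2 exprn_ile1.
- rewrite -[X in _ --> X]subr0; apply: cvgB; first exact: cvg_cst.
  by apply: cvg_natmul_expr; lra.
- exact: cvg_cst.
Qed.

(** By Bernoulli, [(1 - w^n)^K <= 1 / (1 + w^n)^K <= 1 / (1 + K w^n)], and
    [K w^n = n (2w)^n >= n]. *)
Lemma step_poly_cvg0 w : 2^-1 <= w <= 1 -> step_poly ^~ w @ \oo --> (0 : R).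
Proof.
move=> /andP[w0 w1]; have w0' : 0 <= w by lra.
apply: (@squeeze_cvgr _ _ _ _ (fun=> 0) (fun n => n.+1%:R^-1)).
- apply: nearW => n /=.
  have /andP[p0 p1] : 0 <= step_poly n w <= 1 by apply: step_poly_itv; rewrite w0'.
  rewrite p0 /= -[leRHS]mul1r ler_pdivlMr//.
  apply: (@le_trans _ _ (step_poly n w * (1 + (n * 2 ^ n)%:R * w ^+ n))).
    apply: ler_wpM2l => //; rewrite -natr1 addrC lerD2l natrM -mulrA natrX.
    by rewrite -exprMn ler_peMr// exprn_ege1//; lra.
  apply: (@le_trans _ _ (step_poly n w * (1 + w ^+ n) ^+ (n * 2 ^ n))).
    apply: ler_wpM2l => //; apply: bernoulli_ineq.
    by apply: (@le_trans _ _ 0) => //; rewrite exprn_ge0.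
  rewrite /step_poly -exprMn; have wn0 : 0 <= w ^+ n by exact: exprn_ge0.
  have wn1 : w ^+ n <= 1 by exact: exprn_ile1.
  apply: exprn_ile1; first by rewrite mulr_ge0 ?subr_ge0 ?addr_ge0.
  by rewrite -subr_sqr expr1n lerBlDr lerDl sqr_ge0.
- exact: cvg_cst.
- exact: cvg_harmonic.
Qed.

End StepPolynomials.

Local Open Scope complex_scope.

(** * Complex square-integrable functions on the circle *)

Section SquareIntegrable.
Context {R : realType}.
Local Notation mu := (circle_measure R).
Local Notation Re := complex.Re.
Local Notation Im := complex.Im.
Implicit Types (x y w : cfun R) (c z : R[i]).

Lemma circle_measureT : mu setT = 1%E.
Proof. exact: (@probability_setT _ _ R (uniform_prob (twopi_gt0 R))). Qed.

(** The squared modulus with values in [R] rather than in [R[i]], so that it can be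
    integrated. *)
Definition sqnorm (z : R[i]) : R := Re z ^+ 2 + Im z ^+ 2.

Lemma sqnorm_ge0 z : 0 <= sqnorm z.
Proof. by rewrite addr_ge0 ?sqr_ge0. Qed.

Lemma sqnormM (z w : R[i]) : sqnorm (z * w) = sqnorm z * sqnorm w.
Proof. by case: z w => [a b] [c d]; rewrite /sqnorm/=; ring. Qed.

Lemma sqnorm_normc z : ComplexField.Normc.normc z ^+ 2 = sqnorm z.
Proof. by case: z => a b; rewrite /= sqr_sqrtr// addr_ge0 ?sqr_ge0. Qed.

Lemma sqnorm_conj z : sqnorm (conjc z) = sqnorm z.
Proof. by case: z => a b; rewrite /sqnorm/= sqrrN. Qed.

Lemma mul_conj_sqnorm z : z * conjc z = (sqnorm z)%:C.
Proof.
by case: z => a b; rewrite /sqnorm; apply/eqP; rewrite eq_complex/=; apply/andP;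
  split; apply/eqP; ring.
Qed.

Lemma sqnorm_eq0 z : sqnorm z = 0 -> z = 0.
Proof.
rewrite /sqnorm => /eqP; rewrite paddr_eq0 ?sqr_ge0// !sqrf_eq0.
by case: z => a b/= /andP[/eqP -> /eqP ->].
Qed.

Lemma sqnormD_le (z w : R[i]) : sqnorm (z + w) <= 2 * (sqnorm z + sqnorm w).
Proof.
case: z w => [a b] [c d]; rewrite /sqnorm/= -subr_ge0.
rewrite (_ : _ - _ = (a - c) ^+ 2 + (b - d) ^+ 2) ?addr_ge0 ?sqr_ge0//; ring.
Qed.

Definition cmeas x : Prop :=
  measurable_fun setT (fun t => Re (x t)) /\
  measurable_fun setT (fun t => Im (x t)).

Lemma cmeasD x y : cmeas x -> cmeas y -> cmeas (x \+ y).
Proof.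
move=> [mx1 mx2] [my1 my2]; split.
  rewrite (_ : (fun _ => _) = (fun t => Re (x t)) \+ (fun t => Re (y t))).
    exact: measurable_funD.
  by apply/funext => t /=; case: (x t) (y t) => [a b] [].
rewrite (_ : (fun _ => _) = (fun t => Im (x t)) \+ (fun t => Im (y t))).
  exact: measurable_funD.
by apply/funext => t /=; case: (x t) (y t) => [a b] [].
Qed.

Lemma cmeasM x y : cmeas x -> cmeas y -> cmeas (x \* y).
Proof.
move=> [mx1 mx2] [my1 my2]; split.
  rewrite (_ : (fun _ => _) = ((fun t => Re (x t)) \* (fun t => Re (y t))) \-
     ((fun t => Im (x t)) \* (fun t => Im (y t)))).
    by apply: measurable_funB; exact: measurable_funM.
  by apply/funext => t /=; case: (x t) (y t) => [a b] [].
rewrite (_ : (fun _ => _) = ((fun t => Re (x t)) \* (fun t => Im (y t))) \+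
     ((fun t => Im (x t)) \* (fun t => Re (y t)))).
  by apply: measurable_funD; exact: measurable_funM.
by apply/funext => t /=; case: (x t) (y t) => [a b] [].
Qed.

Lemma cmeas_conj x : cmeas x -> cmeas (conjf x).
Proof.
move=> [mx1 mx2]; split.
  rewrite (_ : (fun _ => _) = (fun t => Re (x t)))//.
  by apply/funext => t; rewrite /conjf; case: (x t).
rewrite (_ : (fun _ => _) = \- (fun t => Im (x t))).
  exact: measurable_funN.
by apply/funext => t; rewrite /conjf /=; case: (x t).
Qed.

Lemma cmeas_cst c : cmeas (cst c).
Proof. by split; exact: measurable_cst. Qed.

Lemma measurable_sqnorm x : cmeas x -> measurable_fun setT (fun t => sqnorm (x t)).
Proof.
by move=> [m1 m2]; apply: measurable_funD; exact: measurable_funX.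
Qed.

Lemma ge0_integrable (f : measurableTypeR R -> R) :
  measurable_fun setT f -> (forall t, 0 <= f t) ->
  (\int[mu]_t (f t)%:E < +oo)%E -> mu.-integrable setT (EFin \o f).
Proof.
move=> mf f0 ioo; apply/integrableP; split; first exact/measurable_EFinP.
by under eq_integral => t _ do rewrite /= ger0_norm//.
Qed.

Lemma le_integrable_real (f g : measurableTypeR R -> R) :
  measurable_fun setT f -> (forall t, `|f t| <= g t) ->
  mu.-integrable setT (EFin \o g) -> mu.-integrable setT (EFin \o f).
Proof.
move=> mf fg; apply: le_integrable => //; first exact/measurable_EFinP.
by move=> t _ /=; rewrite lee_fin (le_trans (fg t))// ler_norm.
Qed.

Lemma integrableZ_real (a : R) (f : measurableTypeR R -> R) :
  mu.-integrable setT (EFin \o f) ->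
  mu.-integrable setT (EFin \o (fun t => a * f t)).
Proof. exact: integrableZl. Qed.

(** Finiteness of the 2-norm as integrability, the form that the estimates use. *)
Lemma L2P x : L2 x <->
  cmeas x /\ mu.-integrable setT (EFin \o (fun t => sqnorm (x t))).
Proof.
have nE t : (`|(EFin \o (fun s => ComplexField.Normc.normc (x s))) t| `^ 2 =
    (sqnorm (x t))%:E)%E.
  by rewrite /= -sqnorm_normc powR_mulrn// real_normK ?num_real.
split=> [[m1 m2 n2]|[[m1 m2] i2]].
  split=> //; apply: ge0_integrable; first exact: measurable_sqnorm.
    by move=> t; exact: sqnorm_ge0.
  have := poweR_lty 2 n2; rewrite poweR_Lnorm//.
  by under eq_integral do rewrite nE.
split=> //; apply: (@lty_poweRy _ _ 2) => //; rewrite poweR_Lnorm//.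
under eq_integral do rewrite nE.
exact: (integrable_lty measurableT i2).
Qed.

Lemma L2_cmeas x : L2 x -> cmeas x. Proof. by move=> /L2P[]. Qed.

Definition cinteg x : Prop :=
  mu.-integrable setT (EFin \o (fun t => Re (x t))) /\
  mu.-integrable setT (EFin \o (fun t => Im (x t))).

Lemma Re_le_sqnorm z : `|Re z| <= sqnorm z + 1.
Proof.
case: z => a b /=; rewrite /sqnorm/=.
apply: (le_trans (normr_le_sqr_weight a ltr01)).
by rewrite mul1r invr1 lerD2r lerDl sqr_ge0.
Qed.

Lemma Im_le_sqnorm z : `|Im z| <= sqnorm z + 1.
Proof.
case: z => a b /=; rewrite /sqnorm/=.
apply: (le_trans (normr_le_sqr_weight b ltr01)).
by rewrite mul1r invr1 lerD2r lerDr sqr_ge0.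
Qed.

Lemma Re_mulconj_le (z w : R[i]) : `|Re (z * conjc w)| <= sqnorm z + sqnorm w.
Proof.
case: z w => [a b] [c d]; rewrite /sqnorm/= ler_norml.
have := (sqr_ge0 (a + c), sqr_ge0 (b + d), sqr_ge0 (a - c), sqr_ge0 (b - d)).
have := (sqr_ge0 a, sqr_ge0 b, sqr_ge0 c, sqr_ge0 d).
by move=> [[[? ?] ?] ?] [[[? ?] ?] ?]; apply/andP; split; lra.
Qed.

Lemma Im_mulconj_le (z w : R[i]) : `|Im (z * conjc w)| <= sqnorm z + sqnorm w.
Proof.
case: z w => [a b] [c d]; rewrite /sqnorm/= ler_norml.
have := (sqr_ge0 (a + d), sqr_ge0 (b + c), sqr_ge0 (a - d), sqr_ge0 (b - c)).
have := (sqr_ge0 a, sqr_ge0 b, sqr_ge0 c, sqr_ge0 d).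
by move=> [[[? ?] ?] ?] [[[? ?] ?] ?]; apply/andP; split; lra.
Qed.

Lemma cinteg_mul x y : L2 x -> L2 y -> cinteg (x \* conjf y).
Proof.
move=> /L2P[mx ix] /L2P[my iy].
have [m1 m2] := cmeasM mx (cmeas_conj my).
have ixy : mu.-integrable setT
    (EFin \o (fun t => sqnorm (x t) + sqnorm (y t))).
  rewrite (_ : _ \o _ = ((EFin \o (fun t => sqnorm (x t))) \+
    (EFin \o (fun t => sqnorm (y t)))%E)) //.
  exact: integrableD.
split; apply: le_integrable_real ixy => // t.
  exact: Re_mulconj_le.
exact: Im_mulconj_le.
Qed.

Lemma cconjK c : conjc (conjc c) = c. Proof. exact: conjcK. Qed.
Lemma conjcD c z : conjc (c + z) = conjc c + conjc z. Proof. exact: rmorphD. Qed.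
Lemma conjcB c z : conjc (c - z) = conjc c - conjc z. Proof. exact: rmorphB. Qed.
Lemma conjcM c z : conjc (c * z) = conjc c * conjc z. Proof. exact: rmorphM. Qed.

Lemma cintD x y : cinteg x -> cinteg y -> cint (x \+ y) = cint x + cint y.
Proof.
move=> [x1 x2] [y1 y2]; rewrite /cint; apply/eqP; rewrite eq_complex/=.
by apply/andP; split; apply/eqP; rewrite -RintegralD//;
  apply: eq_Rintegral => t _ /=; case: (x t) (y t) => [a b] [].
Qed.

Lemma cintZ c x : cinteg x -> cint (cst c \* x) = c * cint x.
Proof.
move=> [x1 x2]; rewrite /cint; apply/eqP; rewrite eq_complex/=.
case: c => a b; apply/andP; split; apply/eqP => /=; rewrite -!RintegralZl//.
  rewrite -RintegralB//=; first by apply: eq_Rintegral => t _ /=; case: (x t).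
    exact: integrableZ_real.
  exact: integrableZ_real.
rewrite -RintegralD//=; first by apply: eq_Rintegral => t _ /=; case: (x t).
  exact: integrableZ_real.
exact: integrableZ_real.
Qed.

Lemma cint_conj x : cinteg x -> cint (conjf x) = conjc (cint x).
Proof.
move=> [x1 x2]; rewrite /cint; apply/eqP; rewrite eq_complex/=.
apply/andP; split; apply/eqP.
  by apply: eq_Rintegral => t _ /=; rewrite /conjf; case: (x t).
rewrite -mulN1r -RintegralZl//.
by apply: eq_Rintegral => t _ /=; rewrite /conjf mulN1r; case: (x t).
Qed.

Lemma integrableD_real (f g : measurableTypeR R -> R) :
  mu.-integrable setT (EFin \o f) -> mu.-integrable setT (EFin \o g) ->
  mu.-integrable setT (EFin \o (fun t => f t + g t)).
Proof. exact: integrableD. Qed.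

Lemma L2D x y : L2 x -> L2 y -> L2 (x \+ y).
Proof.
move=> /L2P[mx ix] /L2P[my iy]; apply/L2P; split; first exact: cmeasD.
apply: (@le_integrable_real _ (fun t => 2 * (sqnorm (x t) + sqnorm (y t)))).
- by apply: measurable_sqnorm; exact: cmeasD.
- by move=> t; rewrite ger0_norm ?sqnorm_ge0//; exact: sqnormD_le.
- by apply: integrableZ_real; exact: integrableD_real.
Qed.

Lemma ae_le_integrable_real (f g : measurableTypeR R -> R) :
  measurable_fun setT f -> (forall t, 0 <= f t) ->
  (\forall t \ae mu, f t <= g t) ->
  mu.-integrable setT (EFin \o g) -> mu.-integrable setT (EFin \o f).
Proof.
move=> mf f0 fg ig; apply: ge0_integrable => //.
apply: le_lt_trans (integrable_lty measurableT (integrable_abse ig)).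
apply: ae_ge0_le_integral => //.
- by move=> t _; rewrite lee_fin.
- exact/measurable_EFinP.
- by move=> t _; exact: abse_ge0.
- by have /integrableP[] := integrable_abse ig.
by apply: filterS fg => t h _; rewrite lee_fin (le_trans h)// ler_norm.
Qed.

Lemma LinftyP x : Linfty x <->
  cmeas x /\ exists M, \forall t \ae mu, sqnorm (x t) <= M.
Proof.
have n0 t : 0 <= ComplexField.Normc.normc (x t).
  by case: (x t) => a b /=; exact: sqrtr_ge0.
rewrite /Linfty /cLp/= /finite_norm unlock /Lnorm.
rewrite ifT ?circle_measureT ?lte01//; split=> [[m1 m2]|[[m1 m2] [M hM]]].
  have -> : (abse \o (EFin \o (fun t => ComplexField.Normc.normc (x t))) =
            EFin \o (fun t => ComplexField.Normc.normc (x t)))%E.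
    by apply/funext => t /=; rewrite ger0_norm.
  move=> /ess_supr_bounded[M hM]; split => //; exists (M ^+ 2).
  apply: filterS hM => t h; rewrite -sqnorm_normc ler_pXn2r// nnegrE//.
  exact: le_trans (n0 t) h.
split=> //; apply: (@le_lt_trans _ _ (M + 1)%:E); last exact: ltry.
apply/ess_supP; apply: filterS hM => t h /=; rewrite lee_fin.
rewrite -sqnorm_normc in h; have := n0 t.
have := normr_le_sqr_weight (ComplexField.Normc.normc (x t)) ltr01.
by rewrite mul1r invr1 => /le_trans h1 _; apply: h1; rewrite lerD2r.
Qed.

Lemma L2_mul f x : Linfty f -> L2 x -> L2 (f \* x).
Proof.
move=> /LinftyP[mf [M hM]] /L2P[mx ix]; apply/L2P; split; first exact: cmeasM.
apply: (@ae_le_integrable_real _ (fun t => M * sqnorm (x t))).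
- by apply: measurable_sqnorm; exact: cmeasM.
- by move=> t; exact: sqnorm_ge0.
- apply: filterS hM => t h /=; rewrite sqnormM ler_wpM2r ?sqnorm_ge0//.
- exact: integrableZ_real.
Qed.

Lemma Linfty_bounded x M : cmeas x -> (forall t, sqnorm (x t) <= M) -> Linfty x.
Proof. by move=> mx xM; apply/LinftyP; split => //; exists M; exact: nearW. Qed.

Lemma Linfty_cst c : Linfty (cst c).
Proof. by apply: (@Linfty_bounded _ (sqnorm c)) => //; exact: cmeas_cst. Qed.

Lemma Linfty_conj x : Linfty x -> Linfty (conjf x).
Proof.
move=> /LinftyP[mx [M hM]]; apply/LinftyP; split; first exact: cmeas_conj.
by exists M; apply: filterS hM => t; rewrite /conjf sqnorm_conj.
Qed.

Lemma L2Z c x : L2 x -> L2 (cst c \* x).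
Proof. by move=> x2; apply: L2_mul => //; exact: Linfty_cst. Qed.

Lemma sub_addN x y : x \- y = x \+ (cst (-1) \* y).
Proof. by apply/funext => t /=; rewrite mulN1r. Qed.

Lemma L2B x y : L2 x -> L2 y -> L2 (x \- y).
Proof. by move=> hx hy; rewrite sub_addN; apply: L2D => //; exact: L2Z. Qed.

Lemma L2_conj x : L2 x -> L2 (conjf x).
Proof.
move=> /L2P[mx ix]; apply/L2P; split; first exact: cmeas_conj.
by under eq_fun do rewrite /= /conjf sqnorm_conj.
Qed.

Lemma L2_cst c : L2 (cst c).
Proof.
apply/L2P; split; first exact: cmeas_cst.
exact: (@finite_measure_integrable_cst _ _ _ (uniform_prob (twopi_gt0 R)) setT
  (sqnorm c) measurableT).
Qed.

Lemma L2_Linfty x : Linfty x -> L2 x.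
Proof.
move=> xoo; rewrite (_ : x = x \* cst 1); first by apply: L2_mul => //; exact: L2_cst.
by apply/funext => t /=; rewrite mulr1.
Qed.

Lemma L2_cinteg x : L2 x -> cinteg x.
Proof.
move=> x2; rewrite (_ : x = x \* conjf (cst 1)).
  by apply: cinteg_mul => //; exact: L2_cst.
by apply/funext => t /=; rewrite /conjf conjc1 mulr1.
Qed.

Lemma innerDl x y w : L2 x -> L2 y -> L2 w ->
  inner (x \+ y) w = inner x w + inner y w.
Proof.
move=> x2 y2 w2; rewrite /inner -cintD; try exact: cinteg_mul.
by congr cint; apply/funext => t /=; rewrite mulrDl.
Qed.

Lemma innerZl c x y : L2 x -> L2 y -> inner (cst c \* x) y = c * inner x y.
Proof.
move=> x2 y2; rewrite /inner -cintZ; last exact: cinteg_mul.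
by congr cint; apply/funext => t /=; rewrite mulrA.
Qed.

Lemma innerC x y : L2 x -> L2 y -> conjc (inner x y) = inner y x.
Proof.
move=> x2 y2; rewrite /inner -cint_conj; last exact: cinteg_mul.
by congr cint; apply/funext => t; rewrite /conjf /= conjcM cconjK mulrC.
Qed.

Lemma innerBl x y w : L2 x -> L2 y -> L2 w ->
  inner (x \- y) w = inner x w - inner y w.
Proof.
move=> x2 y2 w2; rewrite sub_addN innerDl//; last exact: L2Z.
by rewrite innerZl// mulN1r.
Qed.

Lemma innerDr x y w : L2 x -> L2 y -> L2 w ->
  inner w (x \+ y) = inner w x + inner w y.
Proof.
move=> x2 y2 w2; rewrite -innerC//; last exact: L2D.
by rewrite innerDl// conjcD !innerC.
Qed.

Lemma innerBr x y w : L2 x -> L2 y -> L2 w ->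
  inner w (x \- y) = inner w x - inner w y.
Proof.
move=> x2 y2 w2; rewrite -innerC//; last exact: L2B.
by rewrite innerBl// conjcB !innerC.
Qed.

Lemma innerZr c x y : L2 x -> L2 y -> inner x (cst c \* y) = conjc c * inner x y.
Proof.
move=> x2 y2; rewrite -innerC//; last exact: L2Z.
by rewrite innerZl// conjcM innerC.
Qed.

Lemma inner_mull f x y : inner (f \* x) y = inner x (conjf f \* y).
Proof.
by congr cint; apply/funext => t; rewrite /conjf /= conjcM cconjK mulrCA mulrA.
Qed.

Definition nrm x : R := \int[mu]_t sqnorm (x t).

Lemma inner_nrm x : L2 x -> inner x x = (nrm x)%:C.
Proof.
move=> /L2P[mx ix]; rewrite /inner /cint /nrm; apply/eqP; rewrite eq_complex/=.
apply/andP; split; apply/eqP.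
  by apply: eq_Rintegral => t _; rewrite /= /conjf mul_conj_sqnorm.
rewrite (_ : 0 = \int[mu]_t 0); last by rewrite Rintegral_cst ?mul0r.
by apply: eq_Rintegral => t _; rewrite /= /conjf mul_conj_sqnorm.
Qed.

Lemma nrm_ge0 x : 0 <= nrm x.
Proof. by apply: Rintegral_ge0 => t _; exact: sqnorm_ge0. Qed.

Lemma nrm_eint x : L2 x -> (\int[mu]_t (sqnorm (x t))%:E = (nrm x)%:E)%E.
Proof.
move=> /L2P[mx ix]; rewrite /nrm /Rintegral fineK//.
exact: (integrable_fin_num measurableT ix).
Qed.

Lemma nrm_eq0 x : L2 x -> nrm x = 0 -> x = cst 0 %[ae mu].
Proof.
move=> x2 n0; have /L2P[mx ix] := x2.
have /(ae_eq_integral_abs mu measurableT) : measurable_fun setT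
    (EFin \o (fun t => sqnorm (x t))).
  by apply/measurable_EFinP; exact: measurable_sqnorm.
move=> [+ _]; under eq_integral do rewrite /= ger0_norm ?sqnorm_ge0//.
rewrite nrm_eint// n0 => /(_ erefl).
by apply: filterS => t + _ => /(_ I) /= [] /sqnorm_eq0.
Qed.

Lemma cint_ae x y : cmeas x -> cmeas y -> x = y %[ae mu] -> cint x = cint y.
Proof.
move=> [x1 x2] [y1 y2] xy; rewrite /cint /Rintegral.
by congr (fine _ +i* fine _); apply: ae_eq_integral => //;
  try exact/measurable_EFinP; apply: filterS xy => t h /h ->.
Qed.

Lemma inner_ael x y w : L2 x -> L2 y -> L2 w -> x = y %[ae mu] ->
  inner x w = inner y w.
Proof.
move=> /L2P[mx _] /L2P[my _] /L2P[mw _] xy.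
apply: cint_ae; try by apply: cmeasM => //; exact: cmeas_conj.
by apply: filterS xy => t h /h /= ->.
Qed.

(** Equality almost everywhere in weak form. All operator identities below are
    reduced by it to identities between inner products. *)
Lemma innerP x y : L2 x -> L2 y ->
  (x = y %[ae mu] <-> forall w, L2 w -> inner x w = inner y w).
Proof.
move=> x2 y2; split=> [xy w w2|xy]; first exact: inner_ael.
have d2 := L2B x2 y2.
have /nrm_eq0 : nrm (x \- y) = 0.
  apply: complexI; rewrite -inner_nrm// innerBl//.
  by rewrite xy// subrr.
move=> /(_ d2); apply: filterS => t h /h /= /eqP; rewrite subr_eq0.
by move=> /eqP.
Qed.

Lemma nrmZ c x : L2 x -> nrm (cst c \* x) = sqnorm c * nrm x.
Proof.
move=> /L2P[mx ix]; rewrite /nrm -RintegralZl//.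
by apply: eq_Rintegral => t _ /=; rewrite sqnormM.
Qed.

Lemma nrmB x y : L2 x -> L2 y ->
  nrm (x \- y) = nrm x + nrm y - 2 * Re (inner x y).
Proof.
move=> x2 y2; apply: complexI; rewrite -inner_nrm; last exact: L2B.
rewrite innerBl ?innerBr//; try exact: L2B.
rewrite -(innerC x2 y2) !inner_nrm//.
case: (inner x y) => a b; apply/eqP; rewrite eq_complex/=; apply/andP.
by split; apply/eqP; ring.
Qed.

(** For [nrm y > 0] this is the positivity of the squared norm of
    [nrm y * x - <x, y> * y]; if [nrm y = 0] then [y] vanishes almost everywhere. *)
Lemma cauchy_schwarz x y : L2 x -> L2 y ->
  sqnorm (inner x y) <= nrm x * nrm y.
Proof.
move=> x2 y2; have [y0|y0] := eqVneq (nrm y) 0.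
  have yE := nrm_eq0 y2 y0.
  rewrite -innerC// (@inner_ael _ (cst 0 \* y) x)//; last 2 first.
    exact: L2Z.
    by apply: filterS yE => t h /h ->; rewrite /= mul0r.
  by rewrite innerZl// mul0r y0 mulr0 rmorph0 /sqnorm/= expr0n/= addr0.
have yp : 0 < nrm y by rewrite lt0r y0 nrm_ge0.
rewrite -(ler_pM2r yp) -subr_ge0.
have -> : nrm x * nrm y * nrm y - sqnorm (inner x y) * nrm y =
   nrm ((cst (nrm y)%:C \* x) \- (cst (inner x y) \* y)).
  rewrite nrmB; try exact: L2Z.
  rewrite !nrmZ// innerZl ?innerZr//; last exact: L2Z.
  rewrite [conjc _ * _]mulrC mul_conj_sqnorm -!rmorphM/=.
  rewrite /sqnorm/= expr0n/=; ring.
exact: nrm_ge0.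
Qed.

(** Completeness, applied to the real and the imaginary parts. *)
Lemma nrm_complete (u : nat -> cfun R) : (forall n, L2 (u n)) ->
  (forall e : R, 0 < e -> exists N, forall m n, (N <= m)%N -> (N <= n)%N ->
     nrm (u m \- u n) <= e) ->
  exists2 y, L2 y & forall e : R, 0 < e ->
    exists N, forall n, (N <= n)%N -> nrm (u n \- y) <= e.
Proof.
move=> u2 cu.
have part (p : R[i] -> R) : (forall z w : R[i], p (z - w) = p z - p w) ->
    (forall z, p z ^+ 2 <= sqnorm z) ->
    (forall n, measurable_fun setT (fun t => p (u n t))) ->
    exists2 y : measurableTypeR R -> R, measurable_fun setT y &
    forall e : R, 0 < e -> exists N, forall n, (N <= n)%N ->
      (\int[mu]_t ((p (u n t) - y t) ^+ 2)%:E <= e%:E)%E.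
  move=> pB pn mp.
  apply: (@L2_complete _ _ _ (uniform_prob (twopi_gt0 R))
    (fun n t => p (u n t))) => // e e0.
  have [N hN] := cu _ e0; exists N => m n Nm Nn.
  have := hN m n Nm Nn; rewrite -lee_fin -nrm_eint; last exact: L2B.
  apply: le_trans; apply: ge0_le_integral => //.
  - by move=> t _; rewrite lee_fin sqr_ge0.
  - apply/measurable_EFinP/measurable_funX.
    by apply: measurable_funB; exact: mp.
  - apply/measurable_EFinP; apply: measurable_sqnorm.
    by have /L2P[] := L2B (u2 m) (u2 n).
  - by move=> t _; rewrite lee_fin -pB; exact: pn.
have [||n|yr myr hr] := part (@complex.Re R).
- by case=> a b [].
- by move=> z; rewrite lerDl sqr_ge0.
- by have /L2P[[]] := u2 n.
have [||n|yi myi hi] := part (@complex.Im R).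
- by case=> a b [].
- by move=> z; rewrite lerDr sqr_ge0.
- by have /L2P[[]] := u2 n.
pose y : cfun R := fun t => yr t +i* yi t.
have my : cmeas y by [].
have key e : 0 < e -> exists N, forall n, (N <= n)%N ->
    (\int[mu]_t (sqnorm ((u n \- y) t))%:E <= e%:E)%E.
  move=> e0; have e2 : 0 < e / 2 by rewrite divr_gt0.
  have [N1 h1] := hr _ e2; have [N2 h2] := hi _ e2.
  exists (maxn N1 N2) => n; rewrite geq_max => /andP[/h1 {}h1 /h2 {}h2].
  rewrite (splitr e) EFinD; apply: le_trans (leeD h1 h2).
  rewrite -ge0_integralD//; last first.
  - apply/measurable_EFinP/measurable_funX; apply: measurable_funB => //.
    by have /L2P[[]] := u2 n.
  - by move=> t _; rewrite lee_fin sqr_ge0.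
  - apply/measurable_EFinP/measurable_funX; apply: measurable_funB => //.
    by have /L2P[[]] := u2 n.
  - by move=> t _; rewrite lee_fin sqr_ge0.
  rewrite le_eqVlt; apply/orP; left; apply/eqP; apply: eq_integral => t _.
  by rewrite /sqnorm /y /=; case: (u n t).
have mu_y n : cmeas (u n \- y).
  by rewrite sub_addN; apply: cmeasD; [exact: L2_cmeas|];
    apply: cmeasM => //; exact: cmeas_cst.
have y2 : L2 y.
  have [N hN] := key 1 ltr01.
  have d2 : L2 (u N \- y).
    apply/L2P; split => //; apply: ge0_integrable.
    - exact: measurable_sqnorm.
    - by move=> t; exact: sqnorm_ge0.
    - by apply: le_lt_trans (hN N (leqnn _)) _; exact: ltry.
  rewrite (_ : y = u N \- (u N \- y)); first exact: L2B.
  by apply/funext => t /=; rewrite subKr.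
exists y => // e /key[N hN]; exists N => n /hN.
by rewrite nrm_eint ?lee_fin//; exact: L2B.
Qed.

End SquareIntegrable.

(** * Multipliers of functions with vanishing Fourier coefficients *)

Section CoefficientMultipliers.
Context {R : realType}.
Local Notation mu := (circle_measure R).
Local Notation Re := complex.Re.
Local Notation Im := complex.Im.
Implicit Types (x y w : cfun R) (c z : R[i]) (g h : measurableTypeR R -> R).

Definition zpow (k : int) : cfun R := fun t => zfun t ^ k.

Lemma sqnorm_zfun (t : R) : sqnorm (zfun t) = 1.
Proof. by rewrite /sqnorm /= cos2Dsin2. Qed.

Lemma zfun_conj (t : R) : zfun t * conjc (zfun t) = 1.
Proof. by rewrite mul_conj_sqnorm sqnorm_zfun. Qed.

Lemma zfun_neq0 (t : R) : zfun t != 0.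
Proof.
apply/eqP => z0; have := zfun_conj t; rewrite z0 mul0r => /eqP.
by rewrite eq_sym oner_eq0.
Qed.

Lemma zfun_inv (t : R) : (zfun t)^-1 = conjc (zfun t).
Proof. by apply: (mulfI (zfun_neq0 t)); rewrite mulfV ?zfun_neq0// zfun_conj. Qed.

Lemma zpowD j k t : zpow (j + k) t = zpow j t * zpow k t.
Proof. by rewrite /zpow expfzDr ?zfun_neq0. Qed.

Lemma zpow0 : zpow 0 = cst 1.
Proof. by apply/funext => t; rewrite /zpow expr0z. Qed.

Lemma zpow1 : zpow 1 = @zfun R.
Proof. by apply/funext => t; rewrite /zpow expr1z. Qed.

Lemma zpowN1 : zpow (-1) = conjf (@zfun R).
Proof. by apply/funext => t; rewrite /zpow /conjf exprN1 zfun_inv. Qed.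

Lemma conjf_zpow k : conjf (zpow k) = zpow (- k).
Proof.
apply/funext => t; rewrite /conjf /zpow -exprz_inv zfun_inv.
case: k => n; first exact: (rmorphXn (@conjc R)).
have cXn (a : R[i]) m : conjc (a ^+ m) = conjc a ^+ m by exact: rmorphXn.
by rewrite /exprz conjc_inv cXn.
Qed.

Lemma sqnorm_zpow k t : sqnorm (zpow k t) = 1.
Proof.
have : (sqnorm (zpow k t))%:C = 1%:C :> R[i].
  rewrite -mul_conj_sqnorm -[conjc _]/(conjf (zpow k) t) conjf_zpow -zpowD.
  by rewrite subrr zpow0.
by move=> /complexI.
Qed.

Lemma cmeas_zfun : cmeas (@zfun R).
Proof.
by split; apply: continuous_measurable_fun;
  [exact: continuous_cos|exact: continuous_sin].
Qed.

Lemma cmeas_zpow k : cmeas (zpow k).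
Proof.
have hn (n : nat) : cmeas (zpow n%:Z).
  elim: n => [|n IH]; first by rewrite zpow0; exact: cmeas_cst.
  rewrite (_ : zpow _ = @zfun R \* zpow n%:Z); first exact/cmeasM/IH/cmeas_zfun.
  by apply/funext => t; rewrite -zpow1 /= -zpowD -PoszD.
case: k => n; first exact: hn.
by rewrite NegzE -conjf_zpow; exact/cmeas_conj/hn.
Qed.

Lemma Linfty_zpow k : Linfty (zpow k).
Proof.
by apply: (@Linfty_bounded _ _ 1 (cmeas_zpow k)) => t; rewrite sqnorm_zpow.
Qed.

Lemma L2_zpow k : L2 (zpow k).
Proof. exact/L2_Linfty/Linfty_zpow. Qed.


Lemma Re_mul_le (z z' : R[i]) M : sqnorm z <= M ->
  `|Re (z * z')| <= (M + 1) * (`|Re z'| + `|Im z'|).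
Proof.
move=> zM; have h1 : `|Re z| <= M + 1.
  by apply: le_trans (Re_le_sqnorm z) _; rewrite lerD2r.
have h2 : `|Im z| <= M + 1.
  by apply: le_trans (Im_le_sqnorm z) _; rewrite lerD2r.
case: z z' h1 h2 {zM} => [a b] [c d] /= h1 h2.
rewrite mulrDr; apply: le_trans (ler_normB _ _) _; rewrite !normrM.
by apply: lerD; exact: ler_wpM2r.
Qed.

Lemma Im_mul_le (z z' : R[i]) M : sqnorm z <= M ->
  `|Im (z * z')| <= (M + 1) * (`|Re z'| + `|Im z'|).
Proof.
move=> zM; have h1 : `|Re z| <= M + 1.
  by apply: le_trans (Re_le_sqnorm z) _; rewrite lerD2r.
have h2 : `|Im z| <= M + 1.
  by apply: le_trans (Im_le_sqnorm z) _; rewrite lerD2r.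
case: z z' h1 h2 {zM} => [a b] [c d] /= h1 h2.
rewrite mulrDr addrC; apply: le_trans (ler_normD _ _) _; rewrite !normrM.
by rewrite addrC [leRHS]addrC; apply: lerD; exact: ler_wpM2r.
Qed.

Lemma cinteg_cmeas x : cinteg x -> cmeas x.
Proof.
by case=> /integrableP[/measurable_EFinP m1 _] /integrableP[/measurable_EFinP].
Qed.

Lemma cinteg_bounded f x M : cmeas f -> (forall t, sqnorm (f t) <= M) ->
  cinteg x -> cinteg (f \* x).
Proof.
move=> mf fM ix; have [m1 m2] := cmeasM mf (cinteg_cmeas ix).
case: ix => i1 i2.
have ib : mu.-integrable setT (EFin \o
    (fun t => (M + 1) * (`|Re (x t)| + `|Im (x t)|))).
  by apply: integrableZ_real; apply: integrableD_real; exact: integrable_norm.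
split; apply: le_integrable_real ib => // t; first exact: Re_mul_le.
exact: Im_mul_le.
Qed.

Lemma cintegD x y : cinteg x -> cinteg y -> cinteg (x \+ y).
Proof.
move=> [x1 x2] [y1 y2]; split.
  rewrite (_ : _ \o _ = EFin \o (fun t => Re (x t) + Re (y t))).
    exact: integrableD_real.
  by apply/funext => t /=; case: (x t) (y t) => [a b] [].
rewrite (_ : _ \o _ = EFin \o (fun t => Im (x t) + Im (y t))).
  exact: integrableD_real.
by apply/funext => t /=; case: (x t) (y t) => [a b] [].
Qed.

Lemma cintegZ c x : cinteg x -> cinteg (cst c \* x).
Proof. by apply: (@cinteg_bounded _ _ (sqnorm c)) => //; exact: cmeas_cst. Qed.

(** The class is taken in L^1 because it must be stable under multiplication by
    bounded functions and under truncation to Borel sets; it turns out to be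
    trivial. *)
Definition nullcoef x : Prop :=
  cinteg x /\ forall k, cint (zpow k \* x) = 0.

Lemma nullcoefD x y : nullcoef x -> nullcoef y -> nullcoef (x \+ y).
Proof.
move=> [ix x0] [iy y0]; split; first exact: cintegD.
move=> k; rewrite (_ : _ \* _ = (zpow k \* x) \+ (zpow k \* y)).
  rewrite cintD ?x0 ?y0 ?addr0//;
    apply: (@cinteg_bounded _ _ 1) => // [|t]; try exact: cmeas_zpow;
    by rewrite sqnorm_zpow.
by apply/funext => t /=; rewrite mulrDr.
Qed.

Lemma cinteg_zpowM k x : cinteg x -> cinteg (zpow k \* x).
Proof.
by apply: (@cinteg_bounded _ _ 1) => [|t]; [exact: cmeas_zpow|rewrite sqnorm_zpow].
Qed.

Lemma nullcoefZ c x : nullcoef x -> nullcoef (cst c \* x).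
Proof.
move=> [ix x0]; split; first exact: cintegZ.
move=> k; rewrite (_ : _ \* _ = cst c \* (zpow k \* x)).
  by rewrite cintZ ?x0 ?mulr0//; exact: cinteg_zpowM.
by apply/funext => t /=; rewrite mulrCA.
Qed.

Lemma nullcoef_zpowM j x : nullcoef x -> nullcoef (zpow j \* x).
Proof.
move=> [ix x0]; split; first exact: cinteg_zpowM.
move=> k; rewrite (_ : _ \* _ = zpow (k + j) \* x); first exact: x0.
by apply/funext => t /=; rewrite zpowD mulrA.
Qed.

Definition rmul g x : cfun R := fun t => (g t)%:C * x t.

(** Bounded real functions that preserve the class [nullcoef]. Since multipliers can
    be composed they form an algebra, and dominated convergence makes this algebra
    closed under bounded pointwise limits. *)
Definition coef_mult g : Prop := [/\ measurable_fun setT g,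
  exists M, forall t, `|g t| <= M & forall x, nullcoef x -> nullcoef (rmul g x)].

Lemma coef_mult_cst (a : R) : coef_mult (cst a).
Proof.
split; [exact: measurable_cst|by exists (`|a|)|].
by move=> x x0; exact: (@nullcoefZ a%:C x x0).
Qed.

Lemma coef_multD g h : coef_mult g -> coef_mult h -> coef_mult (g \+ h).
Proof.
move=> [mg [M gM] ng] [mh [N hN] nh]; split; first exact: measurable_funD.
  by exists (M + N) => t /=; rewrite (le_trans (ler_normD _ _))// lerD.
move=> x x0; rewrite (_ : rmul _ _ = rmul g x \+ rmul h x).
  by apply: nullcoefD; [exact: ng|exact: nh].
by apply/funext => t; rewrite /rmul /= rmorphD mulrDl.
Qed.

Lemma coef_multM g h : coef_mult g -> coef_mult h -> coef_mult (g \* h).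
Proof.
move=> [mg [M gM] ng] [mh [N hN] nh]; split; first exact: measurable_funM.
  by exists (M * N) => t /=; rewrite normrM ler_pM.
move=> x x0; rewrite (_ : rmul _ _ = rmul g (rmul h x)).
  by apply: ng; exact: nh.
by apply/funext => t; rewrite /rmul /= rmorphM mulrA.
Qed.

Lemma coef_multX g n : coef_mult g -> coef_mult (fun t => g t ^+ n).
Proof.
move=> hg; elim: n => [|n IH].
  by under eq_fun do rewrite expr0; exact: coef_mult_cst.
by under eq_fun do rewrite exprS; exact: coef_multM.
Qed.

Lemma coef_multN g : coef_mult g -> coef_mult (\- g).
Proof.
move=> hg; rewrite (_ : \- g = cst (-1) \* g).
  by apply: coef_multM => //; exact: coef_mult_cst.
by apply/funext => t /=; rewrite mulN1r.
Qed.

Lemma coef_multB g h : coef_mult g -> coef_mult h -> coef_mult (g \- h).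
Proof.
move=> hg hh; rewrite (_ : g \- h = g \+ (\- h))//.
by apply: coef_multD => //; exact: coef_multN.
Qed.

(** [cos] is [(z + z^-1) / 2] and multiplication by [z] or [z^-1] only renumbers the
    coefficients. *)
Lemma coef_mult_cos : coef_mult (@cos R).
Proof.
split.
- by have [] := @cmeas_zfun.
- by exists 1 => t; rewrite ler_norml cos_geN1 cos_le1.
move=> x x0.
rewrite (_ : rmul _ _ = cst (2^-1) \* (zpow 1 \* x \+ zpow (-1) \* x)).
  by apply: nullcoefZ; apply: nullcoefD; exact: nullcoef_zpowM.
apply/funext => t; rewrite /rmul /= zpow1 zpowN1 /conjf -mulrDl mulrA.
congr (_ * _); rewrite /zfun; apply: (@mulfI _ 2) => //.
rewrite mulrA mulfV// mul1r.
by apply/eqP; rewrite eq_complex /=; apply/andP; split; apply/eqP; ring.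
Qed.

Lemma coef_mult_sin : coef_mult (@sin R).
Proof.
split.
- by have [] := @cmeas_zfun.
- by exists 1 => t; rewrite ler_norml sin_geN1 sin_le1.
move=> x x0.
rewrite (_ : rmul _ _ = cst (- 'i * 2^-1) \* (zpow 1 \* x \+ cst (-1) \* (zpow (-1) \* x))).
  by apply: nullcoefZ; apply: nullcoefD;
    [|apply: nullcoefZ]; exact: nullcoef_zpowM.
apply/funext => t; rewrite /rmul /= zpow1 zpowN1 /conjf mulrA -mulrDl mulrA.
congr (_ * _); rewrite /zfun mulrAC; apply: (@mulIf _ 2) => //.
rewrite mulfVK//.
by apply/eqP; rewrite eq_complex /=; apply/andP; split; apply/eqP; ring.
Qed.


Lemma Rintegral_mul_lim0 (g_ : nat -> measurableTypeR R -> R) g h M :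
  (forall n, measurable_fun setT (g_ n)) -> (forall n t, `|g_ n t| <= M) ->
  (forall t, g_ ^~ t @ \oo --> g t) -> mu.-integrable setT (EFin \o h) ->
  (forall n, \int[mu]_t (g_ n t * h t) = 0) -> \int[mu]_t (g t * h t) = 0.
Proof.
move=> mg gM gg ih g0.
have mg' : measurable_fun setT g.
  by apply: (measurable_fun_cvg mg) => t _; exact: gg.
have mh : measurable_fun setT h by case/integrableP : ih => /measurable_EFinP.
have M0 : 0 <= M by apply: le_trans (gM 0%N 0).
have iM : mu.-integrable setT (EFin \o (fun t => M * `|h t|)).
  by apply: integrableZ_real; exact: integrable_norm.
pose F n := EFin \o (fun t => g_ n t * h t).
have mF n : measurable_fun setT (F n).
  by apply/measurable_EFinP; exact: measurable_funM.
have mf : measurable_fun setT (EFin \o (fun t => g t * h t)).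
  by apply/measurable_EFinP; exact: measurable_funM.
have cF : \forall t \ae mu, [set: measurableTypeR R] t ->
    F ^~ t @ \oo --> (EFin \o (fun t => g t * h t)) t.
  apply: nearW => t _; apply/fine_cvgP; split; first exact: nearW.
  by apply: cvgM; [exact: gg|exact: cvg_cst].
have bF : \forall t \ae mu, forall n, [set: measurableTypeR R] t ->
    (`|F n t| <= (EFin \o (fun t => (M * `|h t|)%R)) t)%E.
  by apply: nearW => t n _; rewrite lee_fin normrM ler_wpM2r.
have [_ _ cg] := dominated_convergence measurableT mF mf cF iM bF.
have E n : (\int[mu]_t F n t = 0)%E.
  have := g0 n; rewrite /Rintegral => h0.
  rewrite -(@fineK _ (\int[mu]_t F n t)%E) ?h0//.
  apply: integrable_fin_num => //.
  apply: le_integrable_real iM; first exact: measurable_funM.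
  by move=> t; rewrite normrM ler_wpM2r.
rewrite /Rintegral.
have : (fun n => \int[mu]_t F n t)%E @ \oo --> 0%E.
  by under eq_fun do rewrite E; exact: cvg_cst.
by move=> /(cvg_unique _ cg) ->.
Qed.

Lemma cint_rmul g x :
  cint (rmul g x) = (\int[mu]_t (g t * Re (x t))) +i* (\int[mu]_t (g t * Im (x t))).
Proof.
rewrite /cint; congr (_ +i* _); apply: eq_Rintegral => t _; rewrite /rmul;
  by case: (x t) => a b /=; rewrite mul0r ?subr0 ?addr0.
Qed.

Lemma cinteg_rmul g x M : measurable_fun setT g -> (forall t, `|g t| <= M) ->
  cinteg x -> cinteg (rmul g x).
Proof.
move=> mg gM; apply: (@cinteg_bounded _ _ (M ^+ 2)).
  by split => //=; exact: measurable_cst.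
move=> t; rewrite /sqnorm /= expr0n/= addr0 -real_normK ?num_real//.
by rewrite ler_pXn2r// nnegrE// (le_trans _ (gM t)).
Qed.

Lemma zpow_rmul k g x : zpow k \* rmul g x = rmul g (zpow k \* x).
Proof. by apply/funext => t; rewrite /rmul /= mulrCA. Qed.

(** Dominated convergence: multiplied by [g_ n], an integrable function stays below
    [M] times its modulus. *)
Lemma coef_mult_lim (g_ : nat -> measurableTypeR R -> R) g M :
  (forall n, coef_mult (g_ n)) -> (forall n t, `|g_ n t| <= M) ->
  (forall t, g_ ^~ t @ \oo --> g t) -> coef_mult g.
Proof.
move=> hg gM gg; have mg n : measurable_fun setT (g_ n) by case: (hg n).
have mg' : measurable_fun setT g.
  by apply: (measurable_fun_cvg mg) => t _; exact: gg.
have gM' t : `|g t| <= M.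
  rewrite -(cvg_lim _ (cvg_norm (gg t)))//; apply: limr_le.
    by apply: is_cvg_norm; apply/cvg_ex; exists (g t); exact: gg.
  by apply: nearW => n; exact: gM.
split=> //; first by exists M.
move=> x [ix x0]; split; first exact: cinteg_rmul gM' ix.
move=> k; rewrite zpow_rmul cint_rmul.
have [i1 i2] := cinteg_zpowM k ix.
have h n : cint (rmul (g_ n) (zpow k \* x)) = 0.
  by rewrite -zpow_rmul; have [_ _ /(_ x)[]] := hg n.
rewrite (@Rintegral_mul_lim0 g_ g _ M)// => [|n]; last first.
  by have := h n; rewrite cint_rmul => -[].
rewrite (@Rintegral_mul_lim0 g_ g _ M)// => n.
by have := h n; rewrite cint_rmul => -[].
Qed.

Lemma coef_mult_ae g h M : measurable_fun setT h -> (forall t, `|h t| <= M) ->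
  g = h %[ae mu] -> coef_mult g -> coef_mult h.
Proof.
move=> mh hM gh [mg [N gN] ng]; split => //; first by exists M.
move=> x x0; have [ix gx0] := ng x x0; have ihx := cinteg_rmul mh hM x0.1.
split=> // k; rewrite -(gx0 k); apply: cint_ae.
- by apply: cinteg_cmeas; exact: cinteg_zpowM.
- by apply: cinteg_cmeas; exact: cinteg_zpowM.
- by apply: filterS gh => t gh Dt; rewrite /rmul /= gh.
Qed.

(** With [|g| <= M] the function [W = 1/2 - g / (2 (|M| + 1))] has values in [[0, 1]]
    and [g > 0] means [W < 1/2], so the step polynomials in [W] converge to the
    indicator. *)
Lemma coef_mult_gt0 g : coef_mult g ->
  coef_mult (fun t => (0 < g t)%R%:R).
Proof.
move=> hg; have [mg [M gM] _] := hg.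
have M1 : 0 < 2 * (`|M| + 1) by rewrite mulr_gt0// ltr_wpDl.
(* The bound [`|M| + 1] is positive whatever the sign of the given [M]. *)
pose W t := 2^-1 - (2 * (`|M| + 1))^-1 * g t.
have hW : coef_mult W.
  apply: coef_multB; first exact: coef_mult_cst.
  by apply: coef_multM => //; exact: coef_mult_cst.
have gM' t : `|(2 * (`|M| + 1))^-1 * g t| <= 2^-1.
  rewrite normrM gtr0_norm ?invr_gt0// ler_pdivrMl// mulrAC mulfV// mul1r.
  by apply: le_trans (gM t) _; rewrite (le_trans (ler_norm M))// lerDl.
have W01 t : 0 <= W t <= 1.
  have := gM' t; rewrite ler_norml /W => /andP[h1 h2].
  by apply/andP; split; lra.
apply: (@coef_mult_lim (fun n t => step_poly n (W t)) _ 1).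
- move=> n; apply: (@coef_multX (fun t => 1 - W t ^+ n)).
  by apply: coef_multB; [exact: coef_mult_cst|exact: coef_multX].
- move=> n t; have /andP[h1 h2] := step_poly_itv n (W01 t).
  by rewrite ger0_norm.
move=> t; have /andP[w0 w1] := W01 t.
case: ltP => gt0.
  apply: step_poly_cvg1; rewrite w0 /W /= ltrBlDr ltrDl.
  by rewrite mulr_gt0// invr_gt0.
apply: step_poly_cvg0; rewrite w1 andbT /W lerBrDr gerDl.
by rewrite mulr_ge0_le0// invr_ge0 ltW.
Qed.

End CoefficientMultipliers.

(** * Uniqueness of Fourier coefficients *)

Section BorelMultipliers.
Context {R : realType}.
Local Notation mu := (circle_measure R).
Local Notation Re := complex.Re.
Local Notation Im := complex.Im.
Implicit Types (x y w : cfun R) (c z : R[i]) (g h : measurableTypeR R -> R).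

(** The endpoints 0 and [2 pi], where the angle fails to be injective on the circle,
    are discarded. *)
Lemma ae_angle_itv : {ae mu, forall t : measurableTypeR R, 0 < (t : R) < 2 * pi}.
Proof.
exists (~` `]0, (2 * pi)[%classic); split.
- by apply: measurableC; exact: measurable_itv.
- rewrite [LHS]integral_uniform_pdf; apply: null_set_integral.
  + apply: measurableI => //; apply: measurableC; exact: measurable_itv.
  + apply/measurable_EFinP; apply: measurable_funTS.
    exact: measurable_uniform_pdf.
  + apply: countable_lebesgue_measure0.
    apply: (@sub_countable _ _ _ [set 0; 2 * pi]); last exact: finite_set_countable.
    apply: subset_card_le => t [/= h1]; rewrite in_itv/= => /andP[h2 h3].
    move: h1; rewrite in_itv/= => /negP; rewrite negb_and -!leNgt => /orP[h|h].
      by left; apply/eqP; rewrite eq_le h h2.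
    by right; apply/eqP; rewrite eq_le h h3.
- by move=> t /= h; rewrite in_itv/=.
Qed.

(** This function of [cos] and [sin] decreases strictly on the open interval
    []0, 2 pi[], so the initial arcs, which generate the Borel sets, are superlevel
    sets of it. *)
Definition turn (t : R) : R :=
  (1 + cos t) * ((0 < sin t)%R%:R - (0 < - sin t)%R%:R).

Lemma coef_mult_turn : coef_mult turn.
Proof.
apply: coef_multM.
  by apply: coef_multD; [exact: coef_mult_cst|exact: coef_mult_cos].
apply: coef_multB; apply: coef_mult_gt0; first exact: coef_mult_sin.
exact/coef_multN/coef_mult_sin.
Qed.

Lemma turn_lt_pi (t : R) : 0 < t < pi -> turn t = 1 + cos t.
Proof.
move=> /sin_gt0_pi st; rewrite /turn st ltNge oppr_le0 (ltW st)/=.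
by rewrite subr0 mulr1.
Qed.

Lemma turn_gt_pi (t : R) : pi < t < 2 * pi -> turn t = cos (t - pi) - 1.
Proof.
move=> /andP[t1 t2]; rewrite /turn -[in LHS](subrK pi t) sinDpi cosDpi opprK.
have /sin_gt0_pi st : 0 < t - pi < pi by apply/andP; split; lra.
by rewrite st ltNge oppr_le0 (ltW st)/= sub0r mulrN1; ring.
Qed.

Lemma turn_pi : turn pi = 0 :> R.
Proof. by rewrite /turn cospi subrr mul0r. Qed.

Lemma cos_lt_pi (a b : R) : 0 <= a -> a < b -> b <= pi -> cos b < cos a.
Proof.
move=> a0 ab bp; rewrite ltr_cos// in_itv/=; apply/andP; split; lra.
Qed.

Lemma turn_decr (s t : R) : 0 < s -> s < t -> t < 2 * pi -> turn t < turn s.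
Proof.
move=> s0 st t2; have p0 := pi_gt0 R.
have pos a : 0 < a -> a < pi -> 0 < turn a.
  move=> a0 ap; rewrite turn_lt_pi ?a0//.
  by have := @cos_lt_pi a pi (ltW a0) ap (lexx _); rewrite cospi; lra.
have neg a : pi < a -> a < 2 * pi -> turn a < 0.
  move=> a0 ap; rewrite turn_gt_pi ?a0//.
  have := @cos_lt_pi 0 (a - pi) (lexx _); rewrite cos0.
  by rewrite subr_gt0 a0 => /(_ isT) h; have := h _; lra.
case: (ltgtP s pi) => sp; case: (ltgtP t pi) => tp; try lra.
- by rewrite !turn_lt_pi ?s0 ?tp ?(lt_trans s0 st)// ltrD2l; apply: cos_lt_pi; lra.
- by apply: (@lt_trans _ _ 0); [exact: neg|exact: pos].
- by rewrite tp turn_pi; exact: pos.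
- by rewrite !turn_gt_pi ?sp ?tp ?(lt_trans st t2)// ltrD2r; apply: cos_lt_pi; lra.
- by rewrite sp turn_pi; exact: neg.
Qed.

Lemma coef_mult_ray (a : R) : coef_mult \1_(`]-oo, a[%classic).
Proof.
have mi : measurable_fun [set: measurableTypeR R] (\1_(`]-oo, a[) : R -> R).
  by apply: measurable_indic; exact: measurable_itv.
have bi (t : R) : `|\1_(`]-oo, a[) t : R| <= 1.
  by rewrite indicE; case: (_ \in _); rewrite ?normr1 ?normr0.
have iE (t : R) : \1_(`]-oo, a[) t = (t < a)%R%:R :> R.
  rewrite indicE; congr ((nat_of_bool _)%:R); apply/idP/idP; rewrite inE/= in_itv//.
case: (leP a 0) => a0.
  apply: coef_mult_ae mi bi _ (coef_mult_cst 0).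
  apply: filterS ae_angle_itv => t /andP[t0 _] _; rewrite iE.
  by rewrite ltNge (le_trans a0 (ltW t0)).
case: (leP (2 * pi) a) => ap.
  apply: coef_mult_ae mi bi _ (coef_mult_cst 1).
  apply: filterS ae_angle_itv => t /andP[_ t2] _; rewrite iE.
  by rewrite (lt_le_trans t2 ap).
apply: coef_mult_ae mi bi _ (coef_mult_gt0 (coef_multB coef_mult_turn
  (coef_mult_cst (turn a)))).
apply: filterS ae_angle_itv => t /andP[t0 t2] _; rewrite iE /= subr_gt0.
congr ((nat_of_bool _)%:R); case: (ltgtP t a) => ta.
- by rewrite turn_decr.
- by apply/negbTE; rewrite -leNgt ltW// turn_decr.
- by rewrite ta ltxx.
Qed.

(** The Borel sets whose indicators are multipliers form a sigma-algebra, and it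
    contains the rays [t < a]. *)
Lemma coef_mult_indic (A : set (measurableTypeR R)) :
  measurable A -> coef_mult \1_A.
Proof.
pose S := [set A : set R | measurable (A : set (measurableTypeR R)) /\
   coef_mult (\1_A : R -> R)].
suff : sigma_algebra setT S.
  move=> sS mA; suff [] : S A by [].
  move: mA; rewrite [X in X A -> _]RGenInftyO.measurableE => mA.
  apply: (smallest_sub sS) mA => _ [a ->]; split; first exact: measurable_itv.
  exact: coef_mult_ray.
have SC B : S B -> S (~` B).
  move=> [mB hB]; split; first exact: measurableC.
  rewrite (_ : \1_(~` B) = cst 1 \- (\1_B : R -> R)).
    by apply: coef_multB => //; exact: coef_mult_cst.
  apply/funext => t /=; rewrite !indicE in_setC.
  by case: (t \in B); rewrite ?subrr ?subr0.
have SI A' B : S A' -> S B -> S (A' `&` B).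
  move=> [mA hA] [mB hB]; split; first exact: measurableI.
  rewrite (_ : \1_(A' `&` B) = (\1_A' : R -> R) \* (\1_B : R -> R)).
    exact: coef_multM.
  by apply/funext => t /=; rewrite !indicE in_setI -natrM mulnb.
have S0 : S set0.
  by split; [exact: measurable0|rewrite indic0; exact: coef_mult_cst].
split=> //; first by move=> B; rewrite setTD; exact: SC.
move=> F hF; split; first by apply: bigcupT_measurable => n; case: (hF n).
have SU n : S (\big[setU/set0]_(i < n) F i).
  elim: n => [|n IH]; first by rewrite big_ord0.
  by rewrite big_ord_recr /= -[X in S X]setCK setCU; apply/SC/SI; exact: SC.
apply: (@coef_mult_lim _ (fun n => \1_(\big[setU/set0]_(i < n) F i)) _ 1).
- by move=> n; have [] := SU n.
- by move=> n t; rewrite indicE; case: (_ \in _); rewrite ?normr1 ?normr0.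
move=> t; apply: cvg_near_cst.
have [[k _ Fkt]|nFt] := pselect ((\bigcup_n F n) t).
  near=> n; rewrite !indicE; congr ((nat_of_bool _)%:R).
  rewrite [RHS]mem_set; last by exists k.
  by rewrite mem_set// -bigcup_mkord; exists k => //=; near: n; exact: nbhs_infty_gt.
apply: nearW => n; rewrite !indicE; congr ((nat_of_bool _)%:R).
rewrite [RHS]memNset// memNset// -bigcup_mkord => -[k _ Fkt]; apply: nFt.
by exists k.
Unshelve. all: by end_near. Qed.

(** If [x] has no Fourier coefficient, neither has its truncation to a Borel set [A].
    The coefficient of order 0 of the truncation is the integral of [x] over [A]. *)
Lemma nullcoef_eq0 x : nullcoef x -> x = cst 0 %[ae mu].
Proof.
move=> x0; have [[iR iI] _] := x0.
have Rint0 A : measurable A ->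
    (\int[mu]_(t in A) (Re (x t))%:E = 0)%E /\ (\int[mu]_(t in A) (Im (x t))%:E = 0)%E.
  move=> mA; have [_ _ /(_ x x0)[_ /(_ 0)]] := coef_mult_indic mA.
  rewrite zpow_rmul cint_rmul zpow0 => -[].
  have part (f : measurableTypeR R -> R) : mu.-integrable setT (EFin \o f) ->
      \int[mu]_t (\1_A t * f t) = 0 -> (\int[mu]_(t in A) (f t)%:E = 0)%E.
    move=> if_ h; rewrite integral_mkcond.
    transitivity (\int[mu]_t (\1_A t * f t)%:E)%E.
      apply: eq_integral => t _; rewrite patchE indicE.
      by case: (t \in A); rewrite ?mul1r ?mul0r.
    move: h; rewrite /Rintegral => h; rewrite -(@fineK _ (\int[mu]_t _)%E) ?h//.
    apply: integrable_fin_num => //.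
    have mf : measurable_fun setT f by case/integrableP : if_ => /measurable_EFinP.
    apply: (@le_integrable_real _ _ (fun t => `|f t|)).
    - by apply: measurable_funM => //; exact: measurable_indic.
    - by move=> t; rewrite normrM indicE; case: (t \in A);
        rewrite ?normr1 ?normr0 ?mul1r ?mul0r.
    - exact: integrable_norm.
  by move=> h1 h2; split; apply: part => //; [rewrite -[RHS]h1|rewrite -[RHS]h2];
    apply: eq_Rintegral => t _ /=; rewrite mul1r.
have hR : ae_eq mu setT (EFin \o (fun t => Re (x t))) (cst 0%E).
  apply: integral_ae_eq => // E _ mE.
  by rewrite (Rint0 E mE).1 integral0.
have hI : ae_eq mu setT (EFin \o (fun t => Im (x t))) (cst 0%E).
  apply: integral_ae_eq => // E _ mE.
  by rewrite (Rint0 E mE).2 integral0.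
apply: filterS2 hR hI => t /(_ I) /= [h1] /(_ I) /= [h2] _.
by case: (x t) h1 h2 => a b /= -> ->.
Qed.

Lemma fourier_eq0 x : L2 x -> (forall k, fourier x k = 0) -> x = cst 0 %[ae mu].
Proof.
move=> x2 x0; apply: nullcoef_eq0; split; first exact: L2_cinteg.
move=> k; rewrite -(x0 (- k)) /fourier /inner -[X in conjf X]/(zpow (- k)).
by rewrite conjf_zpow opprK; congr cint; apply/funext => t /=; rewrite mulrC.
Qed.

End BorelMultipliers.

(** * Orthonormality of the powers of z *)

Section Orthonormality.
Context {R : realType}.
Local Notation mu := (circle_measure R).

(** The uniform law is evaluated on the nonnegative function [1 + f]: by the
    fundamental theorem of calculus its primitive [t + F t] grows by [2 pi], as if [f]
    were 0. *)
Lemma circle_integral_deriv0 (f F : R -> R) : continuous f ->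
  (forall t, -1 <= f t <= 1) -> (forall t : R, is_derive t 1 F (f t)) ->
  F (2 * pi) = F 0 -> \int[mu]_t f t = 0.
Proof.
move=> cf f1 dF per.
have mf : measurable_fun setT f by exact: continuous_measurable_fun.
have i1 : mu.-integrable setT (EFin \o (fun=> 1) : _ -> \bar R).
  exact: (@finite_measure_integrable_cst _ _ _ (uniform_prob (twopi_gt0 R)) setT).
have if_ : mu.-integrable setT (EFin \o f).
  by apply: (@le_integrable_real _ _ (fun=> 1)) => // t; rewrite ler_norml.
have p0 : 0 < 2 * pi :> R by exact: twopi_gt0.
have dG (t : R) : is_derive t 1 (fun t => t + F t) (1 + f t) by exact: is_deriveD.
have h : (\int[mu]_t (1 + f t)%:E = 1)%E.
  rewrite integral_uniform; last 2 first.
  - by apply/measurable_EFinP; exact: measurable_funD.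
  - by move=> t; rewrite lee_fin; have := f1 t; lra.
  rewrite (@continuous_FTC2 _ (fun t => 1 + f t) (fun t => t + F t)) //.
  - rewrite per subr0 -EFinD -EFinM; congr (_%:E).
    by rewrite add0r addrK mulVf// gt_eqF.
  - apply: continuous_subspaceT => t; apply: cvgD; [exact: cvg_cst|exact: cf].
  - have cG (t : R) : {for t, continuous (fun t => t + F t)}.
      by apply/differentiable_continuous/derivable1_diffP; have [] := dG t.
    split.
    + by move=> t _; have [] := dG t.
    + by apply: cvg_at_right_filter; exact: cG.
    + by apply: cvg_at_left_filter; exact: cG.
  - by move=> t _; rewrite derive1E; have [_ ->] := dG t.
have : \int[mu]_t (1 + f t) = 1 by rewrite /Rintegral h.
rewrite RintegralD// Rintegral_cst// circle_measureT /= mulr1 => /eqP.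
by rewrite -subr_eq0 addrAC subrr add0r => /eqP.
Qed.

Lemma zfunX (t : R) n : zfun t ^+ n = zfun (n%:R * t).
Proof.
elim: n => [|n IH]; first by rewrite expr0 mul0r /zfun cos0 sin0.
rewrite exprS IH -natr1 mulrDl mul1r addrC /zfun cosD sinD.
by apply/eqP; rewrite eq_complex /=; apply/andP; split; apply/eqP; ring.
Qed.

Lemma zfun_2pi n : zfun (n%:R * (2 * pi)) = 1 :> R[i].
Proof.
rewrite -zfunX (_ : zfun _ = 1) ?expr1n//.
have -> : 2 * pi = pi + pi :> R by ring.
rewrite /zfun cosD sinD cospi sinpi.
by rewrite !mulr0 !mul0r mulrNN mulr1 subr0 addr0.
Qed.

Lemma cint_zpow (k : int) : cint (@zpow R k) = (k == 0)%:R.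
Proof.
have [->|k0] := eqVneq k 0.
  rewrite zpow0 /cint /= !Rintegral_cst// mul0r mul1r circle_measureT.
  by [].
have hn (n : nat) : cint (@zpow R n.+1%:Z) = 0.
  pose a : R := n.+1%:R; have a0 : a != 0 by rewrite pnatr_eq0.
  have zE : @zpow R n.+1%:Z = (fun t => zfun (a * t)).
    by apply/funext => t; rewrite /zpow -exprnP zfunX.
  have := zfun_2pi n.+1; rewrite -/a => -[ca sa].
  have dm (t : R) : is_derive t 1 ( *%R a) a.
    by have := is_deriveZ a (is_derive_id t 1); rewrite /GRing.scale /= mulr1.
  have cm : continuous ( *%R a) by exact: mulrl_continuous.
  rewrite zE /cint /=.
  have ds (t : R) : is_derive t 1 (fun t => a^-1 * sin (a * t)) (cos (a * t)).
    have := is_deriveZ a^-1 (is_derive1_comp (is_derive_sin (a * t)) (dm t)).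
    by rewrite /GRing.scale /= mulrCA mulVf// mulr1.
  have dc (t : R) : is_derive t 1 (fun t => - a^-1 * cos (a * t)) (sin (a * t)).
    have := is_deriveZ (- a^-1) (is_derive1_comp (is_derive_cos (a * t)) (dm t)).
    by rewrite /GRing.scale /= mulrCA [- a^-1 * a]mulNr mulVf// mulrN1 opprK.
  have -> : \int[mu]_t cos (a * t) = 0.
    apply: (@circle_integral_deriv0 (fun t => cos (a * t))
      (fun t => a^-1 * sin (a * t))) => //.
    - by move=> t; apply: continuous_comp; [exact: cm|exact: continuous_cos].
    - by move=> t; rewrite cos_geN1 cos_le1.
    - by rewrite sa !mulr0 sin0 mulr0.
  have -> : \int[mu]_t sin (a * t) = 0.
    apply: (@circle_integral_deriv0 (fun t => sin (a * t))
      (fun t => - a^-1 * cos (a * t))) => //.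
    - by move=> t; apply: continuous_comp; [exact: cm|exact: continuous_sin].
    - by move=> t; rewrite sin_geN1 sin_le1.
    - by rewrite ca mulr0 cos0.
  by [].
case: k k0 => [[|n]|n]// _.
rewrite NegzE -conjf_zpow cint_conj ?hn ?conjc0//.
exact/L2_cinteg/L2_zpow.
Qed.

Lemma inner_zpow (j k : int) : inner (@zpow R j) (zpow k) = (j == k)%:R.
Proof.
rewrite /inner conjf_zpow -subr_eq0 -cint_zpow; congr cint.
by apply/funext => t /=; rewrite zpowD.
Qed.

End Orthonormality.

(** * The projection onto H^2 *)

Section Projection.
Context {R : realType}.
Local Notation mu := (circle_measure R).
Implicit Types (x y w h d : cfun R) (c : R[i]) (k : int).

Lemma sqnorm_opp c : sqnorm (- c) = sqnorm c.
Proof. by case: c => a b; rewrite /sqnorm /= !sqrrN. Qed.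

(** Partial sums over the nonnegative orders only: they converge to the projection
    onto H^2. *)
Fixpoint psum x n : cfun R := match n with
  | 0%N => cst 0
  | m.+1 => psum x m \+ (cst (fourier x m%:Z) \* zpow m%:Z)
  end.

Lemma fourierE x k : fourier x k = inner x (zpow k). Proof. by []. Qed.

Definition cvg_nrm (u : nat -> cfun R) y := forall e : R, 0 < e ->
  exists N, forall n, (N <= n)%N -> nrm (u n \- y) <= e.

Lemma L2_psum x n : L2 x -> L2 (psum x n).
Proof.
move=> x2; elim: n => [|n IH] /=; first exact: L2_cst.
by apply: L2D => //; apply: L2Z; exact: L2_zpow.
Qed.

Lemma inner0l y : L2 y -> inner (cst 0) y = 0.
Proof.
move=> y2; rewrite (_ : cst 0 = cst 0 \* y); first by rewrite innerZl// mul0r.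
by apply/funext => t /=; rewrite mul0r.
Qed.

Lemma inner0r y : L2 y -> inner y (cst 0) = 0.
Proof.
by move=> y2; rewrite -innerC ?inner0l ?conjc0//; exact: L2_cst.
Qed.

Lemma inner_psumr x w n : L2 x -> L2 w ->
  inner w (psum x n) = \sum_(k < n) conjc (fourier x k%:Z) * fourier w k%:Z.
Proof.
move=> x2 w2; elim: n => [|n IH] /=; first by rewrite inner0r// big_ord0.
rewrite innerDr//; [|exact: L2_psum|by apply: L2Z; exact: L2_zpow].
by rewrite IH innerZr// ?big_ord_recr//; exact: L2_zpow.
Qed.

Lemma fourier_psum x n k : L2 x ->
  fourier (psum x n) k = if (0 <= k) && (k < n%:Z) then fourier x k else 0.
Proof.
move=> x2; elim: n => [|n IH] /=.
  rewrite /fourier inner0l ?ltNge; last exact: L2_zpow.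
  by case: (0 <= k).
rewrite fourierE innerDl; [|exact: L2_psum| |exact: L2_zpow]; last first.
  by apply: L2Z; exact: L2_zpow.
rewrite -fourierE IH innerZl; try exact: L2_zpow.
rewrite inner_zpow; have [<-|nk] := eqVneq n%:Z k.
  by rewrite ltxx andbF add0r mulr1 lez_nat ltz_nat ltnSn.
rewrite mulr0 addr0; suff -> : (0 <= k) && (k < n.+1) = (0 <= k) && (k < n) by [].
by apply/idP/idP; lia.
Qed.

Definition coef_mass x n : R := \sum_(k < n) sqnorm (fourier x k%:Z).

Lemma inner_psum_self x n : L2 x -> inner x (psum x n) = (coef_mass x n)%:C.
Proof.
move=> x2; rewrite inner_psumr// /coef_mass rmorph_sum /=.
by apply: eq_bigr => i _; rewrite mulrC mul_conj_sqnorm.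
Qed.

Lemma inner_psum_psum x n m : L2 x -> (n <= m)%N ->
  inner (psum x m) (psum x n) = (coef_mass x n)%:C.
Proof.
move=> x2 nm; rewrite -inner_psum_self// !inner_psumr//; last exact: L2_psum.
apply: eq_bigr => i _; rewrite fourier_psum// lez_nat /= ltz_nat.
by rewrite (leq_trans (ltn_ord i) nm).
Qed.

Lemma nrm_psum x n : L2 x -> nrm (psum x n) = coef_mass x n.
Proof.
move=> x2; apply: complexI; rewrite -inner_nrm; last exact: L2_psum.
by rewrite inner_psum_psum.
Qed.

Lemma bessel x n : L2 x -> coef_mass x n <= nrm x.
Proof.
move=> x2; rewrite -subr_ge0 (_ : _ - _ = nrm (x \- psum x n)) ?nrm_ge0//.
rewrite nrmB//; last exact: L2_psum.
by rewrite nrm_psum// inner_psum_self//=; ring.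
Qed.

Lemma nrm_psumB x n m : L2 x -> (n <= m)%N ->
  nrm (psum x m \- psum x n) = coef_mass x m - coef_mass x n.
Proof.
move=> x2 nm; rewrite nrmB; try exact: L2_psum.
by rewrite !nrm_psum// inner_psum_psum//=; ring.
Qed.

Lemma nrm_sym x y : nrm (x \- y) = nrm (y \- x).
Proof.
by apply: eq_Rintegral => t _ /=; rewrite -sqnorm_opp opprB.
Qed.

Lemma psum_cauchy x : L2 x -> forall e : R, 0 < e -> exists N, forall m n,
  (N <= m)%N -> (N <= n)%N -> nrm (psum x m \- psum x n) <= e.
Proof.
move=> x2 e e0; have nd : nondecreasing_seq (coef_mass x).
  apply/nondecreasing_seqP => n; rewrite /coef_mass big_ord_recr/= lerDl.
  exact: sqnorm_ge0.
have ub : has_ubound (range (coef_mass x)).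
  by exists (nrm x) => _ [n _ <-]; exact: bessel.
have cm := nondecreasing_cvgn nd ub.
set l := sup _ in cm.
have lm n : coef_mass x n <= l.
  by apply: ub_le_sup => //; exists n.
have /cvgrPdist_lt /(_ _ e0)[N _ hN] := cm.
exists N; suff h m n : (N <= n)%N -> (n <= m)%N ->
    nrm (psum x m \- psum x n) <= e.
  move=> m n Nm Nn; case: (leqP n m) => nm; first exact: h.
  by rewrite nrm_sym; apply: h => //; exact: ltnW.
move=> Nn nm; rewrite nrm_psumB//.
have := hN n Nn; rewrite ger0_norm ?subr_ge0// => /ltW; apply: le_trans.
by rewrite lerD2r.
Qed.

(** Inner products are continuous in norm, by Cauchy-Schwarz. *)
Lemma inner_cvg_eq (u : nat -> cfun R) y w c : (forall n, L2 (u n)) -> L2 y ->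
  L2 w -> cvg_nrm u y ->
  (exists N, forall n, (N <= n)%N -> inner (u n) w = c) -> inner y w = c.
Proof.
move=> u2 y2 w2 uy [N0 hc].
suff : sqnorm (c - inner y w) <= 0.
  move=> h; have /sqnorm_eq0/eqP : sqnorm (c - inner y w) = 0.
    by apply/eqP; rewrite eq_le h sqnorm_ge0.
  by rewrite subr_eq0 => /eqP.
apply/ler_addgt0Pr => e e0; rewrite add0r.
have w1 : 0 < nrm w + 1 by rewrite ltr_wpDl// nrm_ge0.
have [N1 h1] := uy (e / (nrm w + 1)) (divr_gt0 e0 w1).
have := h1 _ (leq_maxl N1 N0); have := hc _ (leq_maxr N1 N0).
set n := maxn _ _ => <- un.
rewrite -innerBl//; apply: le_trans (cauchy_schwarz _ _) _ => //; first exact: L2B.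
apply: (@le_trans _ _ (e / (nrm w + 1) * nrm w)).
  by rewrite ler_wpM2r// nrm_ge0.
by rewrite mulrAC ler_pdivrMr// ler_wpM2l ?(ltW e0)// lerDl.
Qed.

(** The partial sums are Cauchy by Bessel's inequality; the coefficients of the limit
    are the limits of the coefficients. *)
Lemma psum_cvg x : L2 x -> exists2 y, hardy y &
  cvg_nrm (psum x) y /\ forall k, 0 <= k -> fourier y k = fourier x k.
Proof.
move=> x2; have [y y2 uy] := nrm_complete (fun n => L2_psum n x2) (psum_cauchy x2).
have fy k : fourier y k = if 0 <= k then fourier x k else 0.
  apply: (@inner_cvg_eq (psum x)) => //; first by move=> n; exact: L2_psum.
    exact: L2_zpow.
  exists `|k|.+1%N => n kn; rewrite -fourierE fourier_psum//.
  suff -> : (0 <= k) && (k < n) = (0 <= k) by [].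
  by apply/idP/idP; lia.
exists y; last by split => // k k0; rewrite fy k0.
by split => // k k0; rewrite fy leNgt k0.
Qed.

(** By uniqueness of Fourier coefficients [h] is the limit of its partial sums, and
    each of them is orthogonal to [x]. *)
Lemma hardy_orth_coef x h : L2 x -> (forall k, 0 <= k -> fourier x k = 0) ->
  hardy h -> inner x h = 0.
Proof.
move=> x2 x0 [h2 h0]; have [y [y2 y0] [hy fy]] := psum_cvg h2.
have yx0 : inner y x = 0.
  apply: (@inner_cvg_eq (psum h)) => //; first by move=> n; exact: L2_psum.
  exists 0%N => n _; rewrite -innerC//; last exact: L2_psum.
  rewrite inner_psumr// big1 ?conjc0// => i _.
  by rewrite x0 ?mulr0.
have d0 : y \- h = cst 0 %[ae mu].
  apply: fourier_eq0; first exact: L2B.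
  move=> k; rewrite fourierE innerBl//; last exact: L2_zpow.
  rewrite -!fourierE; case: (leP 0 k) => k0; first by rewrite fy// subrr.
  by rewrite y0// h0// subrr.
have : inner (y \- h) x = 0.
  by rewrite (inner_ael (L2B y2 h2) (L2_cst 0) x2 d0) inner0l.
rewrite innerBl// yx0 sub0r => /eqP; rewrite oppr_eq0 => /eqP hx.
by rewrite -innerC// hx conjc0.
Qed.

Definition hperp : set (cfun R) :=
  [set x | L2 x /\ forall h, hardy h -> inner x h = 0].

Lemma hardy_L2 x : hardy x -> L2 x. Proof. by case. Qed.
Lemma hperp_L2 x : hperp x -> L2 x. Proof. by case. Qed.

Lemma hperpP x : L2 x -> (forall k, 0 <= k -> fourier x k = 0) -> hperp x.
Proof. by move=> x2 x0; split=> // h hh; exact: hardy_orth_coef. Qed.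

Lemma hardy_zpow k : 0 <= k -> hardy (@zpow R k).
Proof.
move=> k0; split; first exact: L2_zpow.
move=> j j0; rewrite fourierE inner_zpow.
by have [jk|//] := eqVneq k j; move: j0; rewrite -jk ltNge k0.
Qed.

Lemma fourier_hperp x k : hperp x -> 0 <= k -> fourier x k = 0.
Proof. by move=> [_ xh] k0; apply: xh; exact: hardy_zpow. Qed.

Lemma fourier_hardy x k : hardy x -> k < 0 -> fourier x k = 0.
Proof. by move=> [_]; apply. Qed.

(** The limit of the partial sums is a candidate for the orthogonal projection, so
    the choice made in [Pplus] is an actual projection. *)
Lemma Pplus_spec x : L2 x ->
  hardy (Pplus x) /\ hperp (Pminus x).
Proof.
move=> x2; have [y hy [_ fy]] := psum_cvg x2.
have : exists y', hardy y' /\ forall h, hardy h -> inner (x \- y') h = 0.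
  have y2 := hardy_L2 hy; exists y; split => // h hh.
  apply: hardy_orth_coef => //; first exact: L2B.
  move=> k k0; rewrite fourierE innerBl//; last exact: L2_zpow.
  by rewrite -!fourierE fy// subrr.
move=> /(@xgetPex _ (fun=> 0) [set y' | hardy y' /\ forall h, hardy h ->
  inner (x \- y') h = 0])[h1 h2].
split => //; split => //; apply: L2B => //; exact: (hardy_L2 h1).
Qed.

Lemma hardy_P x : L2 x -> hardy (Pplus x). Proof. by case/Pplus_spec. Qed.
Lemma hperp_Q x : L2 x -> hperp (Pminus x). Proof. by case/Pplus_spec. Qed.
Lemma L2_P x : L2 x -> L2 (Pplus x). Proof. by move/hardy_P/hardy_L2. Qed.
Lemma L2_Q x : L2 x -> L2 (Pminus x). Proof. by move/hperp_Q/hperp_L2. Qed.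

Lemma PplusD_Pminus x : Pplus x \+ Pminus x = x.
Proof. by apply/funext => t /=; rewrite subrKC. Qed.

Lemma inner_hperp_hardy d h : hperp d -> hardy h -> inner d h = 0.
Proof. by case=> _; apply. Qed.

Lemma inner_hardy_hperp h d : hardy h -> hperp d -> inner h d = 0.
Proof.
by move=> hh hd; rewrite -innerC ?inner_hperp_hardy ?conjc0//;
  [exact: hperp_L2|exact: hardy_L2].
Qed.

Lemma innerPl x h : L2 x -> hardy h -> inner (Pplus x) h = inner x h.
Proof.
move=> x2 hh; rewrite -[in RHS](PplusD_Pminus x) innerDl//.
- by rewrite (inner_hperp_hardy (hperp_Q x2) hh) addr0.
- exact: L2_P.
- exact: L2_Q.
- exact: hardy_L2.
Qed.

Lemma innerQl x d : L2 x -> hperp d -> inner (Pminus x) d = inner x d.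
Proof.
move=> x2 hd; rewrite -[in RHS](PplusD_Pminus x) innerDl//.
- by rewrite (inner_hardy_hperp (hardy_P x2) hd) add0r.
- exact: L2_P.
- exact: L2_Q.
- exact: hperp_L2.
Qed.

Lemma innerPr x h : L2 x -> hardy h -> inner h (Pplus x) = inner h x.
Proof.
move=> x2 hh; have h2 := hardy_L2 hh.
by rewrite -innerC ?innerPl ?innerC//; exact: L2_P.
Qed.

Lemma innerQr x d : L2 x -> hperp d -> inner d (Pminus x) = inner d x.
Proof.
move=> x2 hd; have d2 := hperp_L2 hd.
by rewrite -innerC ?innerQl ?innerC//; exact: L2_Q.
Qed.

Lemma innerP_swap x y : L2 x -> L2 y -> inner (Pplus x) y = inner x (Pplus y).
Proof.
move=> x2 y2; rewrite -innerPr//; last exact: hardy_P.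
by rewrite innerPl//; exact: hardy_P.
Qed.

Lemma innerQ_swap x y : L2 x -> L2 y -> inner (Pminus x) y = inner x (Pminus y).
Proof.
move=> x2 y2; rewrite -innerQr//; last exact: hperp_Q.
by rewrite innerQl//; exact: hperp_Q.
Qed.

Lemma hardyD x y : hardy x -> hardy y -> hardy (x \+ y).
Proof.
move=> [x2 x0] [y2 y0]; split; first exact: L2D.
move=> k k0; rewrite fourierE innerDl -?fourierE ?x0 ?y0 ?addr0//.
exact: L2_zpow.
Qed.

Lemma hardyZ c x : hardy x -> hardy (cst c \* x).
Proof.
move=> [x2 x0]; split; first exact: L2Z.
move=> k k0; rewrite fourierE innerZl -?fourierE ?x0 ?mulr0//.
exact: L2_zpow.
Qed.

Lemma hardyB x y : hardy x -> hardy y -> hardy (x \- y).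
Proof. by move=> hx hy; rewrite sub_addN; apply: hardyD => //; exact: hardyZ. Qed.

Lemma hperpB x y : hperp x -> hperp y -> hperp (x \- y).
Proof.
move=> [x2 x0] [y2 y0]; split; first exact: L2B.
by move=> h hh; rewrite innerBl ?x0 ?y0 ?subrr//; exact: hardy_L2.
Qed.

(** The choice made in [Pplus] determines a projection only up to a null set, so a
    projection is computed by exhibiting a function with the same property. *)
Lemma Pplus_unique x y : L2 x -> hardy y -> hperp (x \- y) ->
  Pplus x = y %[ae mu].
Proof.
move=> x2 hy hxy; have y2 := hardy_L2 hy; have P2 := L2_P x2.
have hd : hardy (Pplus x \- y) by apply: hardyB => //; exact: hardy_P.
have pd : hperp (Pplus x \- y).
  rewrite (_ : _ \- _ = (x \- y) \- Pminus x).
    by apply: hperpB => //; exact: hperp_Q.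
  by apply/funext => t /=; rewrite /Pminus /=; ring.
have d2 := L2B P2 y2.
have /nrm_eq0 : nrm (Pplus x \- y) = 0.
  by apply: complexI; rewrite -inner_nrm// inner_hperp_hardy.
move=> /(_ d2); apply: filterS => t h /h /= /eqP.
by rewrite subr_eq0 => /eqP.
Qed.

Lemma inner_Pplus_unique x y w : L2 x -> hardy y -> hperp (x \- y) -> L2 w ->
  inner (Pplus x) w = inner y w.
Proof.
move=> x2 hy hxy w2; apply: inner_ael => //; first exact: L2_P.
  exact: hardy_L2.
exact: Pplus_unique.
Qed.

Lemma inner_Pminus x w : L2 x -> L2 w ->
  inner (Pminus x) w = inner x w - inner (Pplus x) w.
Proof. by move=> x2 w2; rewrite innerBl//; exact: L2_P. Qed.

End Projection.

(** * The shift and the anti-unitary V *)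

Section ShiftAndV.
Context {R : realType}.
Local Notation z := (@zfun R).
Local Notation zb := (conjf (@zfun R)).
Implicit Types (x y w h d f : cfun R) (c : R[i]) (k : int).

Lemma Linfty_z : Linfty z.
Proof. by rewrite -zpow1; exact: Linfty_zpow. Qed.

Lemma Linfty_zb : Linfty zb.
Proof. exact/Linfty_conj/Linfty_z. Qed.

Lemma L2_z x : L2 x -> L2 (z \* x).
Proof. by move=> x2; apply: L2_mul => //; exact: Linfty_z. Qed.

Lemma L2_zb x : L2 x -> L2 (zb \* x).
Proof. by move=> x2; apply: L2_mul => //; exact: Linfty_zb. Qed.

Lemma L2_zpowM k x : L2 x -> L2 (zpow k \* x).
Proof. by move=> x2; apply: L2_mul => //; exact: Linfty_zpow. Qed.

Lemma fourier_zpowM j k x : fourier (zpow j \* x) k = fourier x (k - j).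
Proof.
rewrite !fourierE inner_mull conjf_zpow; congr inner; apply/funext => t /=.
by rewrite -zpowD addrC.
Qed.

Lemma hardy_zpowM j x : 0 <= j -> hardy x -> hardy (zpow j \* x).
Proof.
move=> j0 [x2 x0]; split; first exact: L2_zpowM.
by move=> k k0; rewrite fourier_zpowM x0//; lia.
Qed.

Lemma hardy_z x : hardy x -> hardy (z \* x).
Proof. by rewrite -zpow1; exact: hardy_zpowM. Qed.

Lemma conjfK x : conjf (conjf x) = x.
Proof. by apply/funext => t; rewrite /conjf cconjK. Qed.

Lemma inner_mulr f x y : inner x (f \* y) = inner (conjf f \* x) y.
Proof. by rewrite inner_mull conjfK. Qed.

Lemma hperp_zb d : hperp d -> hperp (zb \* d).
Proof.
move=> hd; split; first exact/L2_zb/hperp_L2.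
by move=> h hh; rewrite inner_mull conjfK inner_hperp_hardy//; exact: hardy_z.
Qed.

Lemma antiVE x : antiV x = zb \* conjf x. Proof. by []. Qed.

Lemma L2_V x : L2 x -> L2 (antiV x).
Proof. by move=> x2; apply: L2_zb; exact: L2_conj. Qed.

Lemma z_zb (t : R) : z t * zb t = 1. Proof. exact: zfun_conj. Qed.

Lemma antiV_at x t : antiV x t = conjc (z t) * conjc (x t). Proof. by []. Qed.

Lemma antiVK x : antiV (antiV x) = x.
Proof.
apply/funext => t; rewrite !antiV_at conjcM !cconjK mulrA.
by rewrite [conjc _ * _]mulrC zfun_conj mul1r.
Qed.

Lemma inner_VV x y : inner (antiV x) (antiV y) = inner y x.
Proof.
congr cint; apply/funext => t.
rewrite -[LHS]/(antiV x t * conjc (antiV y t)) !antiV_at conjcM !cconjK.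
by rewrite mulrACA [conjc _ * z t]mulrC zfun_conj mul1r mulrC.
Qed.

Lemma inner_Vl x y : inner (antiV x) y = inner (antiV y) x.
Proof. by rewrite -{1}(antiVK y) inner_VV. Qed.

Lemma antiVD x y : antiV (x \+ y) = antiV x \+ antiV y.
Proof. by apply/funext => t; rewrite /= !antiV_at /= conjcD mulrDr. Qed.

Lemma antiV_zpow k : antiV (@zpow R k) = zpow (- k - 1).
Proof.
rewrite antiVE conjf_zpow -zpowN1; apply/funext => t /=.
by rewrite -zpowD addrC.
Qed.

Lemma antiV_mul f x : antiV (f \* x) = conjf f \* antiV x.
Proof.
by apply/funext => t; rewrite antiV_at /= antiV_at conjcM mulrCA.
Qed.

Lemma fourier_V x k : L2 x -> fourier (antiV x) k = conjc (fourier x (- k - 1)).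
Proof.
move=> x2; rewrite !fourierE inner_Vl antiV_zpow innerC//.
exact: L2_zpow.
Qed.

(** [V] sends the coefficient of order [k] to the order [- k - 1], and thus exchanges
    H^2 with its complement. *)
Lemma hperp_V x : hardy x -> hperp (antiV x).
Proof.
move=> hx; have x2 := hardy_L2 hx; apply: hperpP; first exact: L2_V.
by move=> k k0; rewrite fourier_V// (fourier_hardy hx) ?conjc0//; lia.
Qed.

Lemma hardy_V d : hperp d -> hardy (antiV d).
Proof.
move=> hd; have d2 := hperp_L2 hd; split; first exact: L2_V.
by move=> k k0; rewrite fourier_V// (fourier_hperp hd) ?conjc0//; lia.
Qed.

(** [V (P_- x)] lies in H^2 and [V (P_+ x)] in its complement, so these are the two
    parts of [V x]. *)
Lemma inner_PV x w : L2 x -> L2 w ->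
  inner (Pplus (antiV x)) w = inner (antiV (Pminus x)) w.
Proof.
move=> x2 w2; apply: inner_Pplus_unique => //; first exact: L2_V.
  exact/hardy_V/hperp_Q.
rewrite (_ : _ \- _ = antiV (Pplus x)); first exact/hperp_V/hardy_P.
apply/funext => t; rewrite -{1}(PplusD_Pminus x) antiVD /= addrK//.
Qed.

Lemma inner_QV x w : L2 x -> L2 w ->
  inner (Pminus (antiV x)) w = inner (antiV (Pplus x)) w.
Proof.
move=> x2 w2; rewrite inner_Pminus//; last exact: L2_V.
rewrite inner_PV// -{1}(PplusD_Pminus x) antiVD innerDl//; last 2 first.
- exact/L2_V/L2_P.
- exact/L2_V/L2_Q.
by rewrite addrK.
Qed.

Lemma inner_cst1 h : L2 h -> inner (cst 1) h = conjc (fourier h 0).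
Proof.
by move=> h2; rewrite fourierE zpow0 innerC//; exact: L2_cst.
Qed.

Lemma hardy_cst1 : hardy (cst 1 : cfun R).
Proof. by rewrite -zpow0; exact: hardy_zpow. Qed.

Lemma hperp_zbar : hperp zb.
Proof.
rewrite -zpowN1 -[-1](_ : - 0 - 1 = _); last by rewrite oppr0 add0r.
by rewrite -antiV_zpow; apply: hperp_V; exact: hardy_zpow.
Qed.

(** Multiplication by [z] moves exactly one coefficient of [P_- x] into H^2, namely
    the one of order -1, which is [<x, conj z>]. *)
Lemma inner_P_shift x w : L2 x -> L2 w ->
  inner (Pplus (z \* x)) w =
  inner (z \* Pplus x) w + inner x zb * inner (cst 1) w.
Proof.
move=> x2 w2; set c := inner x zb.
have zP2 := L2_z (L2_P x2).
have c2 : L2 (cst c \* cst 1 : cfun R) by exact/L2Z/L2_cst.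
rewrite (@inner_Pplus_unique _ _ ((z \* Pplus x) \+ (cst c \* cst 1)))//.
- by rewrite innerDl// innerZl//; exact: L2_cst.
- exact: L2_z.
- by apply: hardyD; [exact/hardy_z/hardy_P|exact/hardyZ/hardy_cst1].
have -> : z \* x \- (z \* Pplus x \+ cst c \* cst 1) =
          z \* Pminus x \- cst c \* cst 1.
  by apply/funext => t /=; rewrite /Pminus /=; ring.
have zQ2 := L2_z (L2_Q x2).
split; first exact: L2B.
move=> h hh; have h2 := hardy_L2 hh; rewrite innerBl// innerZl//; last exact: L2_cst.
rewrite inner_cst1// inner_mull.
set h0 := fourier h 0.
(* Removing the coefficient of order 0 of [h] keeps [conj z h] in H^2. *)
have hh1 : hardy (zb \* (h \- (cst h0 \* cst 1))).
  have k2 : L2 (h \- (cst h0 \* cst 1)) by apply: L2B => //; exact/L2Z/L2_cst.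
  split; first exact: L2_zb.
  move=> k k0; rewrite -zpowN1 fourier_zpowM opprK fourierE innerBl//;
    try exact: L2_zpow; last exact/L2Z/L2_cst.
  rewrite innerZl; [|exact: L2_cst|exact: L2_zpow].
  rewrite -zpow0 inner_zpow -fourierE.
  have [<-|k1] := eqVneq 0 (k + 1); first by rewrite mulr1 subrr.
  by rewrite mulr0 subr0 (fourier_hardy hh)//; lia.
have -> : zb \* h = (zb \* (h \- (cst h0 \* cst 1))) \+ (cst h0 \* zb).
  by apply/funext => t /=; ring.
rewrite innerDr; last 3 first.
- exact: hardy_L2.
- exact/L2Z/hperp_L2/hperp_zbar.
- exact: L2_Q.
rewrite (inner_hperp_hardy (hperp_Q x2) hh1) add0r innerZr; last 2 first.
- exact: L2_Q.
- exact/hperp_L2/hperp_zbar.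
rewrite innerQl//; last exact: hperp_zbar.
by rewrite mulrC subrr.
Qed.

Lemma inner_Q_shift x w : L2 x -> L2 w ->
  inner (Pminus (z \* x)) w =
  inner (z \* Pminus x) w - inner x zb * inner (cst 1) w.
Proof.
move=> x2 w2; rewrite inner_Pminus//; last exact: L2_z.
rewrite inner_P_shift// opprD addrA -innerBl//; last 2 first.
- exact: L2_z.
- exact/L2_z/L2_P.
congr (inner _ _ - _); apply/funext => t /=; rewrite /Pminus /=; ring.
Qed.

End ShiftAndV.

(** * Hankel forms and the shift *)

Section HankelForms.
Context {R : realType}.
Local Notation mu := (circle_measure R).
Local Notation z := (@zfun R).
Local Notation zb := (conjf (@zfun R)).
Implicit Types (x y w h d f g a b : cfun R) (c : R[i]) (k : int).

Lemma nrm_V x : nrm (antiV x) = nrm x.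
Proof.
apply: eq_Rintegral => t _.
by rewrite antiV_at sqnormM !sqnorm_conj sqnorm_zfun mul1r.
Qed.

Lemma nrm_zpowM k x : nrm (zpow k \* x) = nrm x.
Proof. by apply: eq_Rintegral => t _; rewrite /= sqnormM sqnorm_zpow mul1r. Qed.

Lemma nrm_ae x y : L2 x -> L2 y -> x = y %[ae mu] -> nrm x = nrm y.
Proof.
move=> x2 y2 xy; apply: complexI; rewrite -!inner_nrm//.
by rewrite (inner_ael x2 y2 x2 xy) -innerC// (inner_ael x2 y2 y2 xy) inner_nrm//
  conjc_real.
Qed.

Lemma psum_cvg_P x : L2 x -> cvg_nrm (psum x) (Pplus x).
Proof.
move=> x2; have [y hy [cy fy]] := psum_cvg x2; have y2 := hardy_L2 hy.
have Py : Pplus x = y %[ae mu].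
  apply: Pplus_unique => //; apply: hperpP; first exact: L2B.
  move=> k k0; rewrite fourierE innerBl//; last exact: L2_zpow.
  by rewrite -!fourierE fy// subrr.
move=> e /cy[N hN]; exists N => n /hN; apply: le_trans.
rewrite le_eqVlt; apply/orP; left; apply/eqP; apply: nrm_ae.
- by apply: L2B; [exact: L2_psum|exact: L2_P].
- by apply: L2B => //; exact: L2_psum.
- by apply: filterS Py => t h Dt /=; rewrite h.
Qed.


(** [P_+ (z^-n x)] only depends on the coefficients of [x] of order at least [n],
    which are those of the remainder [P_+ x - psum x n]. *)
Lemma nrm_P_zpow_le x n : L2 x ->
  nrm (Pplus (zpow (- n%:Z) \* x)) <= nrm (psum x n \- Pplus x).
Proof.
move=> x2; set h := Pplus _; have zx2 := L2_zpowM (- n%:Z) x2.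
have hh : hardy h by exact: hardy_P.
have h2 := hardy_L2 hh.
have zh : hardy (zpow n%:Z \* h) by exact: hardy_zpowM.
(* The partial sum is orthogonal to [z^n h], whose coefficients of order less
   than [n] vanish. *)
have hE : (nrm h)%:C = - inner (psum x n \- Pplus x) (zpow n%:Z \* h).
  rewrite -inner_nrm// {1}/h innerPl// inner_mull conjf_zpow opprK.
  rewrite innerBl; [|exact: L2_psum|exact: L2_P|exact: hardy_L2].
  rewrite innerPl// -[inner (psum _ _) _]innerC; [|exact: hardy_L2|exact: L2_psum].
  rewrite inner_psumr//; last exact: hardy_L2.
  rewrite big1 ?conjc0 ?sub0r ?opprK// => i _.
  by rewrite fourier_zpowM (fourier_hardy hh) ?mulr0//; have := ltn_ord i; lia.
have [h0|h0] := eqVneq (nrm h) 0; first by rewrite h0 nrm_ge0.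
have hp : 0 < nrm h by rewrite lt0r h0 nrm_ge0.
rewrite -(ler_pM2r hp).
have -> : nrm h * nrm h = sqnorm (nrm h)%:C by rewrite /sqnorm /= expr0n addr0 expr2.
rewrite hE sqnorm_opp -[X in _ <= _ * X](nrm_zpowM n%:Z).
apply: cauchy_schwarz; last exact: hardy_L2.
by apply: L2B; [exact: L2_psum|exact: L2_P].
Qed.

Lemma nrm_QV x : L2 x -> nrm (Pminus (antiV x)) = nrm (Pplus x).
Proof.
move=> x2; rewrite -[RHS]nrm_V; apply: nrm_ae.
- exact/L2_Q/L2_V.
- exact/L2_V/L2_P.
apply/innerP; [exact/L2_Q/L2_V|exact/L2_V/L2_P|].
by move=> w w2; exact: inner_QV.
Qed.

Lemma antiV_zpowM k x : antiV (zpow k \* x) = zpow (- k) \* antiV x.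
Proof. by rewrite antiV_mul conjf_zpow. Qed.

(** The statement for [P_-] follows from the one for [P_+] through [V], which turns
    [z^n] into [z^-n]. *)
Lemma nrm_Q_zpow_cvg0 x : L2 x -> forall e : R, 0 < e -> exists N, forall n,
  (N <= n)%N -> nrm (Pminus (zpow n%:Z \* x)) <= e.
Proof.
move=> x2 e e0; have [N hN] := psum_cvg_P (L2_V x2) e0.
exists N => n Nn; rewrite -(antiVK (zpow n%:Z \* x)) nrm_QV; last first.
  exact/L2_V/L2_zpowM.
by rewrite antiV_zpowM; apply: le_trans (nrm_P_zpow_le _ (L2_V x2)) _; exact: hN.
Qed.

Lemma nrm_Q_le x : L2 x -> nrm (Pminus x) <= nrm x.
Proof.
move=> x2; have Q2 := L2_Q x2; have P2 := L2_P x2.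
have -> : nrm x = nrm (Pplus x) + nrm (Pminus x).
  apply: complexI; rewrite rmorphD /= -!inner_nrm//.
  have -> : inner x x = inner (Pplus x \+ Pminus x) (Pplus x \+ Pminus x).
    by rewrite PplusD_Pminus.
  rewrite innerDl//; last exact: L2D.
  rewrite !(@innerDr _ (Pplus x) (Pminus x))// (inner_hardy_hperp (hardy_P x2) (hperp_Q x2)).
  by rewrite (inner_hperp_hardy (hperp_Q x2) (hardy_P x2)) addr0 add0r.
by rewrite lerDr nrm_ge0.
Qed.

(** The form [<H_f a, H_g b>] of the product of a Hankel operator with the adjoint of
    another one. *)
Definition hform f g a b : R[i] := inner (Pminus (f \* a)) (Pminus (g \* b)).

(** The functional [<a, V f_->]. On H^2 it gives the coefficient of [f a] of
    order -1, see [inner_zb_coefV]. *)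
Definition coefV f a : R[i] := inner a (antiV (Pminus f)).

(** The part [f_+] does not contribute because [V f_+] is orthogonal to H^2. *)
Lemma inner_zb_coefV f a : Linfty f -> hardy a -> inner (f \* a) zb = coefV f a.
Proof.
move=> foo ha; have f2 := L2_Linfty foo; have a2 := hardy_L2 ha.
transitivity (inner a (antiV f)).
  by rewrite inner_mull; congr inner; apply/funext => t; rewrite /= antiV_at mulrC.
rewrite -{1}(PplusD_Pminus f) antiVD innerDr//; last 2 first.
- exact/L2_V/L2_P.
- exact/L2_V/L2_Q.
by rewrite (inner_hardy_hperp ha (hperp_V (hardy_P f2))) add0r.
Qed.

(** By the shift formula [P_- (z w) = z P_- w - c(w)] with [c(w) = <w, conj z>].
    Expanding the product, the cross terms and the product of constants combine to
    the single rank-one term. *)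
Lemma hform_shift f g a b : Linfty f -> Linfty g -> hardy a -> hardy b ->
  hform f g a b - hform f g (z \* a) (z \* b) = coefV f a * conjc (coefV g b).
Proof.
move=> foo goo ha hb.
have zE q s : q \* (z \* s) = z \* (q \* s).
  by apply/funext => t /=; rewrite mulrCA.
have p2 : L2 (f \* a) by apply: L2_mul => //; exact: hardy_L2.
have q2 : L2 (g \* b) by apply: L2_mul => //; exact: hardy_L2.
rewrite /hform !zE -!inner_zb_coefV//.
move: (f \* a) (g \* b) p2 q2 => p q p2 q2.
have Qp2 := L2_Q p2; have Qq2 := L2_Q q2.
have zQ := hperp_Q (L2_z q2); have zQ2 := hperp_L2 zQ.
have -> : inner (Pminus (z \* p)) (Pminus (z \* q)) =
    inner (z \* Pminus p) (Pminus (z \* q)).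
  rewrite (inner_Q_shift p2 zQ2) (inner_hardy_hperp hardy_cst1 zQ).
  by rewrite mulr0 subr0.
have zQp2 := L2_z Qp2; have zQq2 := L2_z Qq2.
rewrite -(innerC zQ2 zQp2) (inner_Q_shift q2 zQp2).
have -> : inner (z \* Pminus q) (z \* Pminus p) = inner (Pminus q) (Pminus p).
  rewrite inner_mull; congr inner; apply/funext => t.
  rewrite -[LHS]/(zb t * (z t * Pminus p t)) mulrA.
  by rewrite [zb t * _]mulrC z_zb mul1r.
have -> : inner (cst 1) (z \* Pminus p) = conjc (inner p zb).
  rewrite inner_mulr -innerC; [|exact: Qp2|]; last by exact/L2_zb/L2_cst.
  congr conjc; rewrite -(innerQl p2 hperp_zbar); congr inner.
  by apply/funext => t /=; rewrite mulr1.
rewrite conjcB conjcM cconjK (innerC Qq2 Qp2) opprB addrC subrK.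
exact: mulrC.
Qed.

Lemma hform_tail f g a b : Linfty f -> Linfty g -> L2 a -> L2 b ->
  forall e : R, 0 < e -> exists N, forall n, (N <= n)%N ->
  sqnorm (hform f g (zpow n%:Z \* a) (zpow n%:Z \* b)) <= e.
Proof.
move=> foo goo a2 b2 e e0.
have p2 : L2 (f \* a) by exact: L2_mul.
have q2 : L2 (g \* b) by exact: L2_mul.
have K0 : 0 < nrm (g \* b) + 1 by rewrite ltr_wpDl// nrm_ge0.
have [N hN] := nrm_Q_zpow_cvg0 p2 (divr_gt0 e0 K0).
exists N => n /hN h.
have zE s q : s \* (zpow n%:Z \* q) = zpow n%:Z \* (s \* q).
  by apply/funext => t /=; rewrite mulrCA.
rewrite /hform !zE; apply: le_trans (cauchy_schwarz _ _) _.
- exact/L2_Q/L2_zpowM.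
- exact/L2_Q/L2_zpowM.
apply: (@le_trans _ _ (e / (nrm (g \* b) + 1) * (nrm (g \* b) + 1))).
  apply: ler_pM; rewrite ?nrm_ge0//.
  apply: le_trans (nrm_Q_le _) _; first exact: L2_zpowM.
  by rewrite nrm_zpowM lerDl.
by rewrite divfK// gt_eqF.
Qed.

Lemma sqnormB_le (c1 c2 : R[i]) : sqnorm (c1 - c2) <= 2 * (sqnorm c1 + sqnorm c2).
Proof. by rewrite -(sqnorm_opp c2); exact: sqnormD_le. Qed.

Lemma zpow0M x : zpow 0 \* x = x.
Proof. by apply/funext => t; rewrite zpow0 /= mul1r. Qed.

Lemma zpowSM n x : zpow n.+1%:Z \* x = z \* (zpow n%:Z \* x).
Proof. by apply/funext => t /=; rewrite mulrA -zpow1 -zpowD. Qed.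

Lemma leq_sum4 (p q r s : nat) : let n := (p + q + r + s)%N in
  [/\ (p <= n)%N, (q <= n)%N, (r <= n)%N & (s <= n)%N].
Proof. by split; lia. Qed.

Lemma le_four_sixteenths (s p q a1 a2 a3 a4 e : R) : s <= 2 * (p + q) ->
  a1 <= e / 16 -> a2 <= e / 16 -> a3 <= e / 16 -> a4 <= e / 16 ->
  p <= 2 * (a1 + a2) -> q <= 2 * (a3 + a4) -> s <= e.
Proof. lra. Qed.

Lemma sub_combine1 (V : comPzRingType) (s1 s2 s3 s4 t1 t2 t3 t4 e1 e2 e3 e4 : V) :
  t1 - s1 = e1 -> t2 - s2 = e2 -> t3 - s3 = e3 -> t4 - s4 = e4 ->
  t1 - t2 = t3 - t4 -> s1 - s2 = s3 - s4 -> e1 - e2 = e3 - e4.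
Proof.
move=> <- <- <- <- t s.
have -> : t1 - s1 - (t2 - s2) = (t1 - t2) - (s1 - s2) by ring.
by rewrite t s; ring.
Qed.

Lemma sub_combine2 (V : comPzRingType) (s1 s2 s3 s4 t1 t2 t3 t4 e1 e2 e3 e4 : V) :
  t1 - s1 = e1 -> t2 - s2 = e2 -> t3 - s3 = e3 -> t4 - s4 = e4 ->
  e1 - e2 = e3 - e4 -> t1 - t2 - (t3 - t4) = s1 - s2 - (s3 - s4).
Proof.
move=> <- <- <- <- e; apply/eqP; rewrite -subr_eq0.
have -> : t1 - t2 - (t3 - t4) - (s1 - s2 - (s3 - s4)) =
  (t1 - s1 - (t2 - s2)) - (t3 - s3 - (t4 - s4)) by ring.
by rewrite e subrr.
Qed.

(** Let [D] be the difference of the two sides of the first relation. The second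
    relation says that [D (a, b) = D (z a, z b)] by [hform_shift]. It follows at once
    from [D = 0]; conversely it gives [D (a, b) = D (z^n a, z^n b)], which tends to 0
    because [P_- (z^n w)] does. *)
Lemma hform4_coefV f1 g1 f2 g2 f3 g3 f4 g4 :
  Linfty f1 -> Linfty g1 -> Linfty f2 -> Linfty g2 ->
  Linfty f3 -> Linfty g3 -> Linfty f4 -> Linfty g4 ->
  (forall a b, hardy a -> hardy b ->
     hform f1 g1 a b - hform f2 g2 a b = hform f3 g3 a b - hform f4 g4 a b) <->
  (forall a b, hardy a -> hardy b ->
     coefV f1 a * conjc (coefV g1 b) - coefV f2 a * conjc (coefV g2 b) =
     coefV f3 a * conjc (coefV g3 b) - coefV f4 a * conjc (coefV g4 b)).
Proof.
move=> f1o g1o f2o g2o f3o g3o f4o g4o; split=> [hD|hE] a b ha hb.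
  exact: (sub_combine1 (hform_shift f1o g1o ha hb) (hform_shift f2o g2o ha hb)
    (hform_shift f3o g3o ha hb) (hform_shift f4o g4o ha hb)
    (hD _ _ ha hb) (hD _ _ (hardy_z ha) (hardy_z hb))).
pose D a b := (hform f1 g1 a b - hform f2 g2 a b) -
              (hform f3 g3 a b - hform f4 g4 a b).
have DS a' b' : hardy a' -> hardy b' -> D a' b' = D (z \* a') (z \* b').
  move=> ha' hb'.
  exact: (sub_combine2 (hform_shift f1o g1o ha' hb') (hform_shift f2o g2o ha' hb')
    (hform_shift f3o g3o ha' hb') (hform_shift f4o g4o ha' hb') (hE _ _ ha' hb')).
have Dn n : D a b = D (zpow n%:Z \* a) (zpow n%:Z \* b).
  elim: n => [|n IH]; first by rewrite !zpow0M.
  have n0 : (0 : int) <= n%:Z by [].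
  rewrite !zpowSM; apply: (etrans IH).
  exact: (DS _ _ (hardy_zpowM n0 ha) (hardy_zpowM n0 hb)).
suff : sqnorm (D a b) <= 0.
  move=> h; have /sqnorm_eq0/eqP : sqnorm (D a b) = 0.
    by apply/eqP; rewrite eq_le h sqnorm_ge0.
  by rewrite subr_eq0 => /eqP.
apply/ler_addgt0Pr => e e0; rewrite add0r.
(* Splitting the four terms in two steps costs a factor 4 on their sum. *)
have e16 : 0 < e / 16 by rewrite divr_gt0.
have a2 := hardy_L2 ha; have b2 := hardy_L2 hb.
have [N1 h1] := hform_tail f1o g1o a2 b2 e16.
have [N2 h2] := hform_tail f2o g2o a2 b2 e16.
have [N3 h3] := hform_tail f3o g3o a2 b2 e16.
have [N4 h4] := hform_tail f4o g4o a2 b2 e16.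
pose n := (N1 + N2 + N3 + N4)%N.
have [n1 n2 n3 n4] := leq_sum4 N1 N2 N3 N4.
rewrite (Dn n); apply: (le_four_sixteenths _ (h1 _ n1) (h2 _ n2) (h3 _ n3) (h4 _ n4)).
- exact: sqnormB_le.
- exact: sqnormB_le.
- exact: sqnormB_le.
Qed.

End HankelForms.

(** * Commutation in block form *)

Section Blocks.
Context {R : realType}.
Local Notation mu := (circle_measure R).
Implicit Types (x y w h d f g a b : cfun R) (c : cfun R).

Lemma hardy0 : hardy (cst 0 : cfun R).
Proof.
split; first exact: L2_cst.
by move=> k _; rewrite fourierE inner0l//; exact: L2_zpow.
Qed.

Lemma subr_cst0 x : x \- cst 0 = x.
Proof. by apply/funext => t /=; rewrite subr0. Qed.

Lemma inner_P_hardy a w : hardy a -> L2 w -> inner (Pplus a) w = inner a w.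
Proof.
move=> ha w2; have a2 := hardy_L2 ha; apply: inner_Pplus_unique => //.
split; first exact: L2B.
by move=> h hh; rewrite innerBl ?subrr//; exact: hardy_L2.
Qed.

Lemma inner_Q_hardy a w : hardy a -> L2 w -> inner (Pminus a) w = 0.
Proof.
by move=> ha w2; rewrite inner_Pminus ?inner_P_hardy ?subrr//; exact: hardy_L2.
Qed.

Lemma inner_P_hperp d w : hperp d -> L2 w -> inner (Pplus d) w = 0.
Proof.
move=> hd w2; rewrite (@inner_Pplus_unique _ _ (cst 0)) ?inner0l//.
- exact: hperp_L2.
- exact: hardy0.
- by rewrite subr_cst0.
Qed.

Lemma inner_Q_hperp d w : hperp d -> L2 w -> inner (Pminus d) w = inner d w.
Proof.
by move=> hd w2; rewrite inner_Pminus ?inner_P_hperp ?subr0//; exact: hperp_L2.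
Qed.

(** An entry of the block matrix of a product [R_(H1) R_(H2)], as a form: [(f, g)] is
    a column of [H2] and [(p, q)] a row of [H1], the latter moved to the second
    argument as an adjoint. *)
Definition block f g p q a y : R[i] :=
  inner (f \* a) (Pplus (conjf p \* y)) + inner (g \* a) (Pminus (conjf q \* y)).

Lemma L2_Cauchy (H : 'M[cfun R]_2) x : (forall i j, Linfty (H i j)) -> L2 x ->
  L2 (Cauchy_op H x).
Proof.
move=> Hoo x2; have P2 := L2_P x2; have Q2 := L2_Q x2.
apply: L2D; first apply: L2D; first apply: L2D.
- by apply: L2_P; exact: L2_mul.
- by apply: L2_Q; exact: L2_mul.
- by apply: L2_P; exact: L2_mul.
- by apply: L2_Q; exact: L2_mul.
Qed.

Lemma innerD4 x1 x2 x3 x4 w : L2 x1 -> L2 x2 -> L2 x3 -> L2 x4 -> L2 w ->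
  inner (x1 \+ x2 \+ x3 \+ x4) w =
  inner x1 w + inner x2 w + inner x3 w + inner x4 w.
Proof.
move=> h1 h2 h3 h4 hw; have h12 := L2D h1 h2; have h123 := L2D h12 h3.
by rewrite (innerDl h123 h4 hw) (innerDl h12 h3 hw) (innerDl h1 h2 hw).
Qed.

Lemma inner_Cauchy_hardy (H : 'M[cfun R]_2) x b : (forall i j, Linfty (H i j)) ->
  L2 x -> hardy b ->
  inner (Cauchy_op H x) b =
    inner (Pplus x) (conjf (H 0 0) \* b) + inner (Pminus x) (conjf (H 0 1) \* b).
Proof.
move=> Hoo x2 hb; have P2 := L2_P x2; have Q2 := L2_Q x2.
have b2 := hardy_L2 hb.
have M1 := L2_mul (Hoo 0 0) P2; have M2 := L2_mul (Hoo 1 0) P2.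
have M3 := L2_mul (Hoo 0 1) Q2; have M4 := L2_mul (Hoo 1 1) Q2.
rewrite /Cauchy_op (innerD4 (L2_P M1) (L2_Q M2) (L2_P M3) (L2_Q M4) b2).
rewrite (innerPl M1 hb) (innerPl M3 hb) (inner_hperp_hardy (hperp_Q M2) hb).
by rewrite (inner_hperp_hardy (hperp_Q M4) hb) !addr0 -!inner_mull.
Qed.

Lemma inner_Cauchy_hperp (H : 'M[cfun R]_2) x d : (forall i j, Linfty (H i j)) ->
  L2 x -> hperp d ->
  inner (Cauchy_op H x) d =
    inner (Pplus x) (conjf (H 1 0) \* d) + inner (Pminus x) (conjf (H 1 1) \* d).
Proof.
move=> Hoo x2 hd; have P2 := L2_P x2; have Q2 := L2_Q x2.
have d2 := hperp_L2 hd.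
have M1 := L2_mul (Hoo 0 0) P2; have M2 := L2_mul (Hoo 1 0) P2.
have M3 := L2_mul (Hoo 0 1) Q2; have M4 := L2_mul (Hoo 1 1) Q2.
rewrite /Cauchy_op (innerD4 (L2_P M1) (L2_Q M2) (L2_P M3) (L2_Q M4) d2).
rewrite (innerQl M2 hd) (innerQl M4 hd) (inner_hardy_hperp (hardy_P M1) hd).
by rewrite (inner_hardy_hperp (hardy_P M3) hd) add0r addr0 -!inner_mull.
Qed.

Lemma block_split f g p q f' g' x y : Linfty p -> Linfty q -> L2 x -> L2 y ->
  inner (Pplus x) (conjf f \* Pplus (conjf p \* y)) +
  inner (Pminus x) (conjf f' \* Pplus (conjf p \* y)) +
  (inner (Pplus x) (conjf g \* Pminus (conjf q \* y)) +
   inner (Pminus x) (conjf g' \* Pminus (conjf q \* y))) =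
  block f g p q (Pplus x) y + block f' g' p q (Pminus x) y.
Proof.
by move=> po qo x2 y2; rewrite /block -!inner_mull addrACA.
Qed.

Lemma inner_Cauchy2_hardy (H1 H2 : 'M[cfun R]_2) x y :
  (forall i j, Linfty (H1 i j)) -> (forall i j, Linfty (H2 i j)) ->
  L2 x -> hardy y ->
  inner (Cauchy_op H1 (Cauchy_op H2 x)) y =
    block (H2 0 0) (H2 1 0) (H1 0 0) (H1 0 1) (Pplus x) y +
    block (H2 0 1) (H2 1 1) (H1 0 0) (H1 0 1) (Pminus x) y.
Proof.
move=> H1o H2o x2 hy; have R2 := L2_Cauchy H2o x2; have y2 := hardy_L2 hy.
have M0 := L2_mul (Linfty_conj (H1o 0 0)) y2.
have M1 := L2_mul (Linfty_conj (H1o 0 1)) y2.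
rewrite (inner_Cauchy_hardy H1o R2 hy) (innerP_swap R2 M0) (innerQ_swap R2 M1).
rewrite (inner_Cauchy_hardy H2o x2 (hardy_P M0)).
rewrite (inner_Cauchy_hperp H2o x2 (hperp_Q M1)).
exact: block_split.
Qed.

Lemma inner_Cauchy2_hperp (H1 H2 : 'M[cfun R]_2) x y :
  (forall i j, Linfty (H1 i j)) -> (forall i j, Linfty (H2 i j)) ->
  L2 x -> hperp y ->
  inner (Cauchy_op H1 (Cauchy_op H2 x)) y =
    block (H2 0 0) (H2 1 0) (H1 1 0) (H1 1 1) (Pplus x) y +
    block (H2 0 1) (H2 1 1) (H1 1 0) (H1 1 1) (Pminus x) y.
Proof.
move=> H1o H2o x2 hy; have R2 := L2_Cauchy H2o x2; have y2 := hperp_L2 hy.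
have M0 := L2_mul (Linfty_conj (H1o 1 0)) y2.
have M1 := L2_mul (Linfty_conj (H1o 1 1)) y2.
rewrite (inner_Cauchy_hperp H1o R2 hy) (innerP_swap R2 M0) (innerQ_swap R2 M1).
rewrite (inner_Cauchy_hardy H2o x2 (hardy_P M0)).
rewrite (inner_Cauchy_hperp H2o x2 (hperp_Q M1)).
exact: block_split.
Qed.

Lemma block_id f g p q x x' y : Linfty f -> Linfty g -> Linfty p -> Linfty q ->
  (forall w, L2 w -> inner x w = inner x' w) -> L2 y ->
  block f g p q x y = block f g p q x' y.
Proof.
move=> fo go po qo xx y2; rewrite /block !inner_mull.
have A := L2_P (L2_mul (Linfty_conj po) y2).
have B := L2_Q (L2_mul (Linfty_conj qo) y2).
by rewrite (xx _ (L2_mul (Linfty_conj fo) A)) (xx _ (L2_mul (Linfty_conj go) B)).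
Qed.

Lemma block0 f g p q y : Linfty f -> Linfty g -> Linfty p -> Linfty q -> L2 y ->
  block f g p q (cst 0) y = 0.
Proof.
move=> fo go po qo y2; rewrite /block !inner_mull.
have A := L2_P (L2_mul (Linfty_conj po) y2).
have B := L2_Q (L2_mul (Linfty_conj qo) y2).
rewrite (inner0l (L2_mul (Linfty_conj fo) A)).
by rewrite (inner0l (L2_mul (Linfty_conj go) B)) addr0.
Qed.

Lemma block_hardy f g p q f' g' a y : Linfty f -> Linfty g -> Linfty f' ->
  Linfty g' -> Linfty p -> Linfty q -> hardy a -> L2 y ->
  block f g p q (Pplus a) y + block f' g' p q (Pminus a) y = block f g p q a y.
Proof.
move=> fo go f'o g'o po qo ha y2.
rewrite (block_id fo go po qo (fun w => @inner_P_hardy a w ha) y2).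
rewrite (@block_id f' g' p q (Pminus a) (cst 0))//.
  by rewrite (block0 f'o g'o po qo y2) addr0.
by move=> w w2; rewrite inner_Q_hardy// inner0l.
Qed.

Lemma block_hperp f g p q f' g' d y : Linfty f -> Linfty g -> Linfty f' ->
  Linfty g' -> Linfty p -> Linfty q -> hperp d -> L2 y ->
  block f g p q (Pplus d) y + block f' g' p q (Pminus d) y = block f' g' p q d y.
Proof.
move=> fo go f'o g'o po qo hd y2.
rewrite (block_id f'o g'o po qo (fun w => @inner_Q_hperp d w hd) y2).
rewrite (@block_id f g p q (Pplus d) (cst 0))//.
  by rewrite (block0 fo go po qo y2) add0r.
by move=> w w2; rewrite inner_P_hperp// inner0l.
Qed.

Lemma inner_split x y : L2 x -> L2 y ->
  inner x y = inner x (Pplus y) + inner x (Pminus y).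
Proof.
move=> x2 y2; rewrite -(@innerDr _ (Pplus y) (Pminus y) x) ?PplusD_Pminus//.
- exact: L2_P.
- exact: L2_Q.
Qed.

(** The four identities between blocks are obtained by testing on vectors of H^2 and
    of its complement; they suffice since every vector splits into two such parts. *)
Lemma Cauchy_commute_blocks (H1 H2 : 'M[cfun R]_2) :
  (forall i j, Linfty (H1 i j)) -> (forall i j, Linfty (H2 i j)) ->
  eq_operator L2 (Cauchy_op H1 \o Cauchy_op H2) (Cauchy_op H2 \o Cauchy_op H1) <->
  [/\ forall a b, hardy a -> hardy b ->
        block (H2 0 0) (H2 1 0) (H1 0 0) (H1 0 1) a b =
        block (H1 0 0) (H1 1 0) (H2 0 0) (H2 0 1) a b,
      forall c b, hperp c -> hardy b ->
        block (H2 0 1) (H2 1 1) (H1 0 0) (H1 0 1) c b =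
        block (H1 0 1) (H1 1 1) (H2 0 0) (H2 0 1) c b,
      forall a d, hardy a -> hperp d ->
        block (H2 0 0) (H2 1 0) (H1 1 0) (H1 1 1) a d =
        block (H1 0 0) (H1 1 0) (H2 1 0) (H2 1 1) a d &
      forall c d, hperp c -> hperp d ->
        block (H2 0 1) (H2 1 1) (H1 1 0) (H1 1 1) c d =
        block (H1 0 1) (H1 1 1) (H2 1 0) (H2 1 1) c d].
Proof.
move=> H1o H2o.
have eqE x : L2 x -> (Cauchy_op H1 (Cauchy_op H2 x) =
    Cauchy_op H2 (Cauchy_op H1 x) %[ae mu] <->
    forall y, L2 y -> inner (Cauchy_op H1 (Cauchy_op H2 x)) y =
      inner (Cauchy_op H2 (Cauchy_op H1 x)) y).
  move=> x2; apply: innerP; do 2 apply: L2_Cauchy => //.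
split=> [comm|[c11 c12 c21 c22] x x2].
  have commE x y : L2 x -> L2 y -> inner (Cauchy_op H1 (Cauchy_op H2 x)) y =
      inner (Cauchy_op H2 (Cauchy_op H1 x)) y.
    by move=> x2; apply: (eqE x x2).1; exact: comm.
  split=> x y hx hy.
  - have x2 := hardy_L2 hx; have y2 := hardy_L2 hy.
    have e1 := (block_hardy (H2o 0 0) (H2o 1 0) (H2o 0 1) (H2o 1 1)
      (H1o 0 0) (H1o 0 1) hx y2).
    have e2 := (block_hardy (H1o 0 0) (H1o 1 0) (H1o 0 1) (H1o 1 1)
      (H2o 0 0) (H2o 0 1) hx y2).
    apply: (etrans (esym e1)); apply: etrans e2.
    apply: (etrans (esym (inner_Cauchy2_hardy H1o H2o x2 hy))).
    exact: (etrans (commE _ _ x2 y2) (inner_Cauchy2_hardy H2o H1o x2 hy)).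
  - have x2 := hperp_L2 hx; have y2 := hardy_L2 hy.
    have e1 := (block_hperp (H2o 0 0) (H2o 1 0) (H2o 0 1) (H2o 1 1)
      (H1o 0 0) (H1o 0 1) hx y2).
    have e2 := (block_hperp (H1o 0 0) (H1o 1 0) (H1o 0 1) (H1o 1 1)
      (H2o 0 0) (H2o 0 1) hx y2).
    apply: (etrans (esym e1)); apply: etrans e2.
    apply: (etrans (esym (inner_Cauchy2_hardy H1o H2o x2 hy))).
    exact: (etrans (commE _ _ x2 y2) (inner_Cauchy2_hardy H2o H1o x2 hy)).
  - have x2 := hardy_L2 hx; have y2 := hperp_L2 hy.
    have e1 := (block_hardy (H2o 0 0) (H2o 1 0) (H2o 0 1) (H2o 1 1)
      (H1o 1 0) (H1o 1 1) hx y2).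
    have e2 := (block_hardy (H1o 0 0) (H1o 1 0) (H1o 0 1) (H1o 1 1)
      (H2o 1 0) (H2o 1 1) hx y2).
    apply: (etrans (esym e1)); apply: etrans e2.
    apply: (etrans (esym (inner_Cauchy2_hperp H1o H2o x2 hy))).
    exact: (etrans (commE _ _ x2 y2) (inner_Cauchy2_hperp H2o H1o x2 hy)).
  - have x2 := hperp_L2 hx; have y2 := hperp_L2 hy.
    have e1 := (block_hperp (H2o 0 0) (H2o 1 0) (H2o 0 1) (H2o 1 1)
      (H1o 1 0) (H1o 1 1) hx y2).
    have e2 := (block_hperp (H1o 0 0) (H1o 1 0) (H1o 0 1) (H1o 1 1)
      (H2o 1 0) (H2o 1 1) hx y2).
    apply: (etrans (esym e1)); apply: etrans e2.
    apply: (etrans (esym (inner_Cauchy2_hperp H1o H2o x2 hy))).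
    exact: (etrans (commE _ _ x2 y2) (inner_Cauchy2_hperp H2o H1o x2 hy)).
apply/(eqE x x2) => y y2.
have hPx := hardy_P x2; have hQx := hperp_Q x2.
have hPy := hardy_P y2; have hQy := hperp_Q y2.
apply: (etrans (inner_split (L2_Cauchy H1o (L2_Cauchy H2o x2)) y2)).
apply: etrans (esym (inner_split (L2_Cauchy H2o (L2_Cauchy H1o x2)) y2)).
have e1 := etrans (inner_Cauchy2_hardy H1o H2o x2 hPy) (etrans
  (f_equal2 +%R (c11 _ _ hPx hPy) (c12 _ _ hQx hPy))
  (esym (inner_Cauchy2_hardy H2o H1o x2 hPy))).
have e2 := etrans (inner_Cauchy2_hperp H1o H2o x2 hQy) (etrans
  (f_equal2 +%R (c21 _ _ hPx hQy) (c22 _ _ hQx hQy))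
  (esym (inner_Cauchy2_hperp H2o H1o x2 hQy))).
exact: (f_equal2 +%R e1 e2).
Qed.

End Blocks.

(** * The blocks as operator equations *)

Lemma diag_eq1 (V : comPzRingType) (s h1 h2 h3 h4 : V) :
  (s - h1 + h2 = s - h3 + h4) <-> (h1 - h2 = h3 - h4).
Proof.
split=> e; apply/eqP; rewrite -subr_eq0; apply/eqP.
  rewrite (_ : _ - _ = (s - h3 + h4) - (s - h1 + h2)); last by ring.
  by rewrite e subrr.
rewrite (_ : _ - _ = (h3 - h4) - (h1 - h2)); last by ring.
by rewrite e subrr.
Qed.

Lemma diag_eq2 (V : comPzRingType) (s h1 h2 h3 h4 : V) :
  (h1 + (s - h2) = h3 + (s - h4)) <-> (h1 - h2 = h3 - h4).
Proof.
have e1 (p q : V) : p + (s - q) = s + (p - q) by ring.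
rewrite !e1; split=> [/addrI//|->//].
Qed.

Lemma add2_sub2 (V : comPzRingType) (i1 i2 i3 i4 k1 k2 k3 k4 : V) :
  i1 = k1 -> i2 = k2 -> i3 = k3 -> i4 = k4 ->
  i1 + i2 - i3 - i4 = k1 + k2 - (k3 + k4).
Proof. by move=> -> -> -> ->; ring. Qed.

Lemma add_shift_eq (V : comPzRingType) (s1 s2 e1 e2 : V) :
  s1 + e1 + (s2 - e2) - (s1 + s2) = e1 - e2.
Proof. ring. Qed.

Section Equations.
Context {R : realType}.
Local Notation mu := (circle_measure R).
Local Notation z := (@zfun R).
Local Notation zb := (conjf (@zfun R)).
Implicit Types (x y w h d f g a b p q : cfun R).

(** A product of Toeplitz operators is the Toeplitz operator of the product of the
    symbols up to a product of Hankel operators. *)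
Lemma block_hform f g p q a b : Linfty f -> Linfty g -> Linfty p -> Linfty q ->
  hardy a -> hardy b ->
  block f g p q a b = inner (f \* a) (conjf p \* b) - hform f (conjf p) a b
                      + hform g (conjf q) a b.
Proof.
move=> fo go po qo ha hb; have a2 := hardy_L2 ha; have b2 := hardy_L2 hb.
have fa := L2_mul fo a2; have ga := L2_mul go a2.
have pb := L2_mul (Linfty_conj po) b2; have qb := L2_mul (Linfty_conj qo) b2.
rewrite /block /hform (innerQl ga (hperp_Q qb)) (innerQl fa (hperp_Q pb)).
by rewrite (inner_split fa pb) addrK.
Qed.

(** The Toeplitz operator of the product of the symbols is symmetric in the two
    factors, so it cancels from the commutator. *)
Lemma inner_mulM_sym f g a b : inner (f \* a) (conjf g \* b) =
  inner (g \* a) (conjf f \* b).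
Proof.
rewrite !inner_mulr !conjfK; congr inner; apply/funext => t /=.
exact: mulrCA.
Qed.

Lemma block_diag_hardy f1 g1 u1 f2 g2 u2 : Linfty f1 -> Linfty g1 -> Linfty u1 ->
  Linfty f2 -> Linfty g2 -> Linfty u2 ->
  (forall a b, hardy a -> hardy b -> block f2 g2 f1 u1 a b = block f1 g1 f2 u2 a b)
  <-> (forall a b, hardy a -> hardy b ->
    hform f2 (conjf f1) a b - hform g2 (conjf u1) a b =
    hform f1 (conjf f2) a b - hform g1 (conjf u2) a b).
Proof.
move=> f1o g1o u1o f2o g2o u2o; split=> e a b ha hb; move: (e a b ha hb);
  rewrite (block_hform f2o g2o f1o u1o ha hb) (block_hform f1o g1o f2o u2o ha hb);
  rewrite (inner_mulM_sym f1 f2).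
  by move=> /diag_eq1.
by move=> ?; apply/diag_eq1.
Qed.

Lemma inner_P_antiV x y : L2 x -> L2 y ->
  inner (antiV x) (Pplus (antiV y)) = inner (Pminus y) x.
Proof.
move=> x2 y2; have Vx := L2_V x2; have Vy := L2_V y2.
rewrite -(innerC (L2_P Vy) Vx) inner_PV// innerC//; last exact/L2_V/L2_Q.
exact: inner_VV.
Qed.

Lemma inner_Q_antiV x y : L2 x -> L2 y ->
  inner (antiV x) (Pminus (antiV y)) = inner (Pplus y) x.
Proof.
move=> x2 y2; have Vx := L2_V x2; have Vy := L2_V y2.
rewrite -(innerC (L2_Q Vy) Vx) inner_QV// innerC//; last exact/L2_V/L2_P.
exact: inner_VV.
Qed.

Lemma mul_antiV f a : f \* antiV a = antiV (conjf f \* a).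
Proof. by rewrite antiV_mul conjfK. Qed.

(** Conjugation by [V] turns the dual Toeplitz operators into Toeplitz operators, so
    the block on the complement of H^2 is also expressed by Hankel forms on H^2, with
    the arguments exchanged. *)
Lemma block_antiV u v g w a b : Linfty u -> Linfty v -> Linfty g -> Linfty w ->
  hardy a -> hardy b ->
  block u v g w (antiV a) (antiV b) = hform g (conjf u) b a +
    (inner (w \* b) (conjf v \* a) - hform w (conjf v) b a).
Proof.
move=> uo vo go wo ha hb; have a2 := hardy_L2 ha; have b2 := hardy_L2 hb.
have ua := L2_mul (Linfty_conj uo) a2; have va := L2_mul (Linfty_conj vo) a2.
have gb := L2_mul go b2; have wb := L2_mul wo b2.
rewrite /block !mul_antiV !conjfK (inner_P_antiV ua gb) (inner_Q_antiV va wb).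
rewrite /hform; congr (_ + _).
  by rewrite (innerQ_swap gb ua) (innerQl gb (hperp_Q ua)).
rewrite (inner_split wb va) (innerP_swap wb va) (innerQl wb (hperp_Q va)).
by rewrite addrK.
Qed.

Lemma block_diag_hperp g1 u1 v1 g2 u2 v2 : Linfty g1 -> Linfty u1 -> Linfty v1 ->
  Linfty g2 -> Linfty u2 -> Linfty v2 ->
  (forall c d, hperp c -> hperp d -> block u2 v2 g1 v1 c d = block u1 v1 g2 v2 c d)
  <-> (forall b a, hardy b -> hardy a ->
    hform g1 (conjf u2) b a - hform v1 (conjf v2) b a =
    hform g2 (conjf u1) b a - hform v2 (conjf v1) b a).
Proof.
move=> g1o u1o v1o g2o u2o v2o.
have key a b : hardy a -> hardy b ->
    (block u2 v2 g1 v1 (antiV a) (antiV b) = block u1 v1 g2 v2 (antiV a) (antiV b))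
    <-> (hform g1 (conjf u2) b a - hform v1 (conjf v2) b a =
         hform g2 (conjf u1) b a - hform v2 (conjf v1) b a).
  move=> ha hb; rewrite (block_antiV u2o v2o g1o v1o ha hb).
  rewrite (block_antiV u1o v1o g2o v2o ha hb) (inner_mulM_sym v1 v2).
  exact: diag_eq2.
split=> [e b a hb ha|e c d hc hd].
  by apply: (key a b ha hb).1; apply: e; exact: hperp_V.
have := (key _ _ (hardy_V hc) (hardy_V hd)).2; rewrite !antiVK; apply.
by apply: e; exact: hardy_V.
Qed.

Lemma hperpD x y : hperp x -> hperp y -> hperp (x \+ y).
Proof.
move=> [x2 x0] [y2 y0]; split; first exact: L2D.
by move=> h hh; rewrite innerDl ?x0 ?y0 ?addr0//; exact: hardy_L2.
Qed.

Lemma hperp_eq0 x : hperp x ->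
  (x = cst 0 %[ae mu] <-> forall d, hperp d -> inner x d = 0).
Proof.
move=> hx; have x2 := hperp_L2 hx; split=> [x0 d hd|x0].
  have d2 := hperp_L2 hd.
  by rewrite (inner_ael x2 (L2_cst 0) d2 x0) inner0l.
by apply: nrm_eq0 => //; apply: complexI; rewrite -inner_nrm// x0.
Qed.

Lemma inner_DBB x1 x2 x3 x4 w : L2 x1 -> L2 x2 -> L2 x3 -> L2 x4 -> L2 w ->
  inner (x1 \+ x2 \- x3 \- x4) w =
  inner x1 w + inner x2 w - inner x3 w - inner x4 w.
Proof.
move=> h1 h2 h3 h4 hw; have h12 := L2D h1 h2; have h123 := L2B h12 h3.
by rewrite (innerBl h123 h4 hw) (innerBl h12 h3 hw) (innerDl h1 h2 hw).
Qed.

(** The operator on the left maps [a] into the complement of H^2, so the image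
    vanishes iff it is orthogonal to every [d] there, and the inner product with [d]
    is the difference of the two blocks. *)
Lemma Hankel_equation_block f1 g1 v1 f2 g2 v2 : Linfty f1 -> Linfty g1 ->
  Linfty v1 -> Linfty f2 -> Linfty g2 -> Linfty v2 ->
  eq_operator hardy
    ((Hankel g1 \o Toeplitz f2) + (dualToeplitz v1 \o Hankel g2)
     - (Hankel g2 \o Toeplitz f1) - (dualToeplitz v2 \o Hankel g1)) 0 <->
  forall a d, hardy a -> hperp d -> block f2 g2 g1 v1 a d = block f1 g1 g2 v2 a d.
Proof.
move=> f1o g1o v1o f2o g2o v2o.
pose X1 a := Pminus (g1 \* Pplus (f2 \* a)).
pose X2 a := Pminus (v1 \* Pminus (g2 \* a)).
pose X3 a := Pminus (g2 \* Pplus (f1 \* a)).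
pose X4 a := Pminus (v2 \* Pminus (g1 \* a)).
pose X a := X1 a \+ X2 a \- X3 a \- X4 a.
have hX a d : hardy a -> hperp d -> hperp (X a) /\
    inner (X a) d = block f2 g2 g1 v1 a d - block f1 g1 g2 v2 a d.
  move=> ha hd; have a2 := hardy_L2 ha; have d2 := hperp_L2 hd.
  have f1a := L2_mul f1o a2; have f2a := L2_mul f2o a2.
  have g1a := L2_mul g1o a2; have g2a := L2_mul g2o a2.
  have Y1 := L2_mul g1o (L2_P f2a); have Y2 := L2_mul v1o (L2_Q g2a).
  have Y3 := L2_mul g2o (L2_P f1a); have Y4 := L2_mul v2o (L2_Q g1a).
  have h1 := hperp_Q Y1; have h2 := hperp_Q Y2.
  have h3 := hperp_Q Y3; have h4 := hperp_Q Y4.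
  have h12 := hperpD h1 h2; have h123 := hperpB h12 h3.
  split; first exact: (hperpB h123 h4).
  have PE s r : Linfty s -> L2 r -> inner (Pminus (s \* Pplus r)) d =
      inner r (Pplus (conjf s \* d)).
    move=> so r2; rewrite (innerQl (L2_mul so (L2_P r2)) hd) inner_mull.
    exact: (innerP_swap r2 (L2_mul (Linfty_conj so) d2)).
  have QE s r : Linfty s -> L2 r -> inner (Pminus (s \* Pminus r)) d =
      inner r (Pminus (conjf s \* d)).
    move=> so r2; rewrite (innerQl (L2_mul so (L2_Q r2)) hd) inner_mull.
    exact: (innerQ_swap r2 (L2_mul (Linfty_conj so) d2)).
  apply: (etrans (inner_DBB (hperp_L2 h1) (hperp_L2 h2) (hperp_L2 h3)
    (hperp_L2 h4) d2)).
  exact: (add2_sub2 (PE _ _ g1o f2a) (QE _ _ v1o g2a) (PE _ _ g2o f1a)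
    (QE _ _ v2o g1a)).
split=> [e a d ha hd|e a ha].
  have [hXa Xd] := hX a d ha hd.
  by apply/subr0_eq; rewrite -Xd; exact: ((hperp_eq0 hXa).1 (e a ha) d hd).
have hX0 d : hperp d -> inner (X a) d = 0.
  move=> hd; apply: (etrans (hX a d ha hd).2).
  by apply/eqP; rewrite subr_eq0; apply/eqP; exact: e.
have hXa : hperp (X a).
  have h0 : hperp (cst 0 : cfun R).
    apply: hperpP => [|k _]; first exact: L2_cst.
    by rewrite fourierE inner0l//; exact: L2_zpow.
  exact: (hX a _ ha h0).1.
exact: (hperp_eq0 hXa).2 hX0.
Qed.

(** The defects of [P_+] and [P_-] with respect to the shift are opposite multiples
    of the constant function 1. *)
Lemma block_shift f g p q a d : Linfty f -> Linfty g -> Linfty p -> Linfty q ->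
  hardy a -> hperp d ->
  block f g p q (z \* a) d - block f g p q a (zb \* d) =
  coefV f a * inner p d - coefV g a * inner q d.
Proof.
move=> fo go po qo ha hd; have a2 := hardy_L2 ha; have d2 := hperp_L2 hd.
have fa := L2_mul fo a2; have ga := L2_mul go a2.
have pd := L2_mul (Linfty_conj po) d2; have qd := L2_mul (Linfty_conj qo) d2.
have zE (s r : cfun R) : s \* (z \* r) = z \* (s \* r).
  by apply/funext => t; exact: mulrCA.
have zbE (s r : cfun R) : s \* (zb \* r) = zb \* (s \* r).
  by apply/funext => t; exact: mulrCA.
have c1 s : inner (cst 1) (conjf s \* d) = inner s d.
  rewrite inner_mulr conjfK; congr inner; apply/funext => t; exact: mulr1.
have p1 : inner (f \* (z \* a)) (Pplus (conjf p \* d)) =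
    inner (f \* a) (Pplus (conjf p \* (zb \* d))) + coefV f a * inner p d.
  rewrite zE zbE -(innerP_swap (L2_z fa) pd) (inner_P_shift fa pd).
  rewrite -(innerP_swap fa (L2_zb pd)) inner_mull c1.
  by rewrite (inner_zb_coefV fo ha).
have p2 : inner (g \* (z \* a)) (Pminus (conjf q \* d)) =
    inner (g \* a) (Pminus (conjf q \* (zb \* d))) - coefV g a * inner q d.
  rewrite zE zbE -(innerQ_swap (L2_z ga) qd) (inner_Q_shift ga qd).
  rewrite -(innerQ_swap ga (L2_zb qd)) inner_mull c1.
  by rewrite (inner_zb_coefV go ha).
rewrite /block p1 p2; exact: add_shift_eq.
Qed.

(** Comparing the block identity at [(z a, d)] and at [(a, conj z d)]: the
    off-diagonal part of the tensor equation is a consequence of the first two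
    operator equations. *)
Lemma block_offdiag f1 g1 v1 f2 g2 v2 : Linfty f1 -> Linfty g1 ->
  Linfty v1 -> Linfty f2 -> Linfty g2 -> Linfty v2 ->
  (forall a d, hardy a -> hperp d -> block f2 g2 g1 v1 a d = block f1 g1 g2 v2 a d) ->
  forall a d, hardy a -> hperp d ->
    coefV f2 a * inner g1 d - coefV g2 a * inner v1 d =
    coefV f1 a * inner g2 d - coefV g1 a * inner v2 d.
Proof.
move=> f1o g1o v1o f2o g2o v2o e a d ha hd.
apply: (etrans (esym (block_shift f2o g2o g1o v1o ha hd))).
apply: etrans (block_shift f1o g1o g2o v2o ha hd).
exact: (f_equal2 (fun s t => s - t) (e _ _ (hardy_z ha) hd) (e _ _ ha (hperp_zb hd))).
Qed.

(** Taking adjoints turns the block from the complement of H^2 to H^2 into a block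
    in the other direction. *)
Lemma block_conj f g p q a d : Linfty f -> Linfty g -> Linfty p -> Linfty q ->
  L2 a -> L2 d ->
  block (conjf p) (conjf q) (conjf f) (conjf g) a d = conjc (block f g p q d a).
Proof.
move=> fo go po qo a2 d2; rewrite /block !conjfK conjcD.
have fd := L2_mul fo d2; have gd := L2_mul go d2.
have pa := L2_mul (Linfty_conj po) a2; have qa := L2_mul (Linfty_conj qo) a2.
rewrite (innerC fd (L2_P pa)) (innerC gd (L2_Q qa)).
by rewrite (innerP_swap pa fd) (innerQ_swap qa gd).
Qed.

End Equations.

(** * The tensor equation in block form *)

Lemma add_comb_eq (V : comPzRingType) (k1 k2 k3 k4 l1 l2 l3 l4 i1 i2 i3 i4 : V) :
  k1 * i1 - k2 * i2 = k3 * i3 - k4 * i4 ->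
  l1 * i1 - l2 * i2 = l3 * i3 - l4 * i4 ->
  (k1 + l1) * i1 - (k2 + l2) * i2 = (k3 + l3) * i3 - (k4 + l4) * i4.
Proof.
move=> e1 e2; have E (k k' l l' i i' : V) : (k + l) * i - (k' + l') * i' =
    (k * i - k' * i') + (l * i - l' * i') by ring.
by rewrite !E e1 e2.
Qed.

Lemma comb_congr (V : comPzRingType) (a1 b1 a2 b2 a3 b3 a4 b4 c1 d1 c2 d2 c3 d3 c4 d4 : V) :
  a1 = c1 -> b1 = d1 -> a2 = c2 -> b2 = d2 ->
  a3 = c3 -> b3 = d3 -> a4 = c4 -> b4 = d4 ->
  a1 * b1 - a2 * b2 = a3 * b3 - a4 * b4 ->
  c1 * d1 - c2 * d2 = c3 * d3 - c4 * d4.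
Proof. by move=> -> -> -> -> -> -> -> ->. Qed.

Lemma comb_swap (V : comPzRingType) (a1 b1 a2 b2 a3 b3 a4 b4 : V) :
  a1 * b1 - a2 * b2 = a3 * b3 - a4 * b4 ->
  b1 * a1 - b2 * a2 = b3 * a3 - b4 * a4.
Proof.
by rewrite (mulrC a1) (mulrC a2) (mulrC a3) (mulrC a4).
Qed.

Section Tensors.
Context {R : realType}.
Local Notation mu := (circle_measure R).
Implicit Types (x y w h d f g a b p q r s : cfun R).

Lemma ae_comb_inner (k1 k2 k3 k4 : R[i]) p1 p2 p3 p4 :
  L2 p1 -> L2 p2 -> L2 p3 -> L2 p4 ->
  (((k1 \*o p1) \- (k2 \*o p2) : cfun R) = (k3 \*o p3) \- (k4 \*o p4) %[ae mu]) <->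
  (forall y, L2 y -> k1 * inner p1 y - k2 * inner p2 y =
                     k3 * inner p3 y - k4 * inner p4 y).
Proof.
move=> h1 h2 h3 h4.
have E k k' p q y : L2 p -> L2 q -> L2 y ->
    inner ((cst k \* p) \- (cst k' \* q)) y = k * inner p y - k' * inner q y.
  move=> hp hq y2; rewrite (innerBl (L2Z k hp) (L2Z k' hq) y2).
  by rewrite (innerZl k hp y2) (innerZl k' hq y2).
have A := L2B (L2Z k1 h1) (L2Z k2 h2); have B := L2B (L2Z k3 h3) (L2Z k4 h4).
split=> [e y y2|e].
  apply: (etrans (esym (E k1 k2 p1 p2 y h1 h2 y2))).
  exact: (etrans (inner_ael A B y2 e) (E k3 k4 p3 p4 y h3 h4 y2)).
apply: (innerP A B).2 => y y2.
apply: (etrans (E k1 k2 p1 p2 y h1 h2 y2)).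
exact: (etrans (e y y2) (esym (E k3 k4 p3 p4 y h3 h4 y2))).
Qed.


(** Pairing both components with a function [y] and testing on [(x, 0)] and [(0, x)]
    separates the four entries. *)
Lemma tensor_equation_blocks p1 p2 p3 p4 q1 q2 q3 q4 r1 r2 r3 r4 s1 s2 s3 s4 :
  L2 p1 -> L2 p2 -> L2 p3 -> L2 p4 -> L2 q1 -> L2 q2 -> L2 q3 -> L2 q4 ->
  L2 r1 -> L2 r2 -> L2 r3 -> L2 r4 -> L2 s1 -> L2 s2 -> L2 s3 -> L2 s4 ->
  eq_operator2 (tensor2 (p1, r1) (q1, s1) - tensor2 (p2, r2) (q2, s2))
               (tensor2 (p3, r3) (q3, s3) - tensor2 (p4, r4) (q4, s4)) <->
  forall x y, L2 x -> L2 y ->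
  [/\ inner x q1 * inner p1 y - inner x q2 * inner p2 y =
      inner x q3 * inner p3 y - inner x q4 * inner p4 y,
      inner x s1 * inner p1 y - inner x s2 * inner p2 y =
      inner x s3 * inner p3 y - inner x s4 * inner p4 y,
      inner x q1 * inner r1 y - inner x q2 * inner r2 y =
      inner x q3 * inner r3 y - inner x q4 * inner r4 y &
      inner x s1 * inner r1 y - inner x s2 * inner r2 y =
      inner x s3 * inner r3 y - inner x s4 * inner r4 y].
Proof.
move=> hp1 hp2 hp3 hp4 hq1 hq2 hq3 hq4 hr1 hr2 hr3 hr4 hs1 hs2 hs3 hs4.
have z2 : L2 (cst 0 : cfun R) by exact: L2_cst.
split=> [e x y x2 y2|e [x1 x2] /= hx1 hx2].
  have [/= e1 e1'] := e (x, cst 0) x2 z2; have [/= e2 e2'] := e (cst 0, x) z2 x2.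
  have := (ae_comb_inner _ _ _ _ hp1 hp2 hp3 hp4).1 e1 y y2.
  have := (ae_comb_inner _ _ _ _ hp1 hp2 hp3 hp4).1 e2 y y2.
  have := (ae_comb_inner _ _ _ _ hr1 hr2 hr3 hr4).1 e1' y y2.
  have := (ae_comb_inner _ _ _ _ hr1 hr2 hr3 hr4).1 e2' y y2.
  rewrite /inner2 /=.
  rewrite (inner0l hq1) (inner0l hq2) (inner0l hq3) (inner0l hq4).
  rewrite (inner0l hs1) (inner0l hs2) (inner0l hs3) (inner0l hs4).
  by rewrite !add0r !addr0.
split.
  apply: (ae_comb_inner _ _ _ _ hp1 hp2 hp3 hp4).2 => y y2.
  have [e1 _ _ _] := e x1 y hx1 y2; have [_ e2 _ _] := e x2 y hx2 y2.
  exact: add_comb_eq.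
apply: (ae_comb_inner _ _ _ _ hr1 hr2 hr3 hr4).2 => y y2.
have [_ _ e1 _] := e x1 y hx1 y2; have [_ _ _ e2] := e x2 y hx2 y2.
exact: add_comb_eq.
Qed.

Lemma coefV_P f x : L2 f -> L2 x -> coefV f (Pplus x) = inner x (antiV (Pminus f)).
Proof.
by move=> f2 x2; rewrite /coefV innerPl//; exact/hardy_V/hperp_Q.
Qed.

Lemma conj_coefV_P f y : L2 f -> L2 y ->
  conjc (coefV f (Pplus y)) = inner (antiV (Pminus f)) y.
Proof.
by move=> f2 y2; rewrite coefV_P// innerC//; exact/L2_V/L2_Q.
Qed.

(** Together with [coefV_P], this reads every vector of the tensor equation as a
    functional on H^2: those in the complement are transported by [V]. *)
Lemma coefV_VQ f x : L2 f -> L2 x ->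
  coefV f (antiV (Pminus x)) = inner (Pminus f) x.
Proof.
by move=> f2 x2; rewrite /coefV inner_VV innerQr//; exact: hperp_Q.
Qed.

Lemma conj_coefV_VQ f x : L2 f -> L2 x ->
  conjc (coefV f (antiV (Pminus x))) = inner x (Pminus f).
Proof. by move=> f2 x2; rewrite coefV_VQ// innerC//; exact: L2_Q. Qed.

Lemma inner_Vr x y : L2 x -> L2 y -> inner x (antiV y) = inner y (antiV x).
Proof.
move=> x2 y2; rewrite -(innerC (L2_V y2) x2) inner_Vl innerC//.
exact: L2_V.
Qed.



Lemma comb_conj (a1 b1 a2 b2 a3 b3 a4 b4 : R[i]) :
  a1 * b1 - a2 * b2 = a3 * b3 - a4 * b4 ->
  conjc a1 * conjc b1 - conjc a2 * conjc b2 =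
  conjc a3 * conjc b3 - conjc a4 * conjc b4.
Proof. by move=> /(f_equal conjc); rewrite !conjcB !conjcM. Qed.

End Tensors.

Theorem theorem4p1 (R : realType) (H1 H2 : 'M[cfun R]_2)
    (hH1 : forall i j, Linfty (H1 i j)) (hH2 : forall i j, Linfty (H2 i j)) :
  let f1 := H1 0 0 in let u1 := H1 0 1 in
  let g1 := H1 1 0 in let v1 := H1 1 1 in
  let f2 := H2 0 0 in let u2 := H2 0 1 in
  let g2 := H2 1 0 in let v2 := H2 1 1 in
  eq_operator L2 (Cauchy_op H1 \o Cauchy_op H2) (Cauchy_op H2 \o Cauchy_op H1)
  <->
  [/\ eq_operator hardy
        ((Hankel (conjf u2) \o Toeplitz (conjf f1))
         + (dualToeplitz (conjf v2) \o Hankel (conjf u1))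
         - (Hankel (conjf u1) \o Toeplitz (conjf f2))
         - (dualToeplitz (conjf v1) \o Hankel (conjf u2)))
        0,
      eq_operator hardy
        ((Hankel g1 \o Toeplitz f2) + (dualToeplitz v1 \o Hankel g2)
         - (Hankel g2 \o Toeplitz f1) - (dualToeplitz v2 \o Hankel g1))
        0
    & eq_operator2
        (tensor2 (antiV (Pminus (conjf f1)), Pminus g1)
                 (antiV (Pminus f2), Pminus (conjf u2))
         - tensor2 (antiV (Pminus (conjf u1)), Pminus v1)
                   (antiV (Pminus g2), Pminus (conjf v2)))
        (tensor2 (antiV (Pminus (conjf f2)), Pminus g2)
                 (antiV (Pminus f1), Pminus (conjf u1))
         - tensor2 (antiV (Pminus (conjf u2)), Pminus v2)
                   (antiV (Pminus g1), Pminus (conjf v1)))].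
Proof.
move=> f1 u1 g1 v1 f2 u2 g2 v2.
have commE := Cauchy_commute_blocks hH1 hH2.
rewrite -/f1 -/u1 -/g1 -/v1 -/f2 -/u2 -/g2 -/v2 in commE.
have f1o : Linfty f1 by exact: hH1. have u1o : Linfty u1 by exact: hH1.
have g1o : Linfty g1 by exact: hH1. have v1o : Linfty v1 by exact: hH1.
have f2o : Linfty f2 by exact: hH2. have u2o : Linfty u2 by exact: hH2.
have g2o : Linfty g2 by exact: hH2. have v2o : Linfty v2 by exact: hH2.
clearbody f1 u1 g1 v1 f2 u2 g2 v2.
have f1c := Linfty_conj f1o; have u1c := Linfty_conj u1o.
have v1c := Linfty_conj v1o; have f2c := Linfty_conj f2o.
have u2c := Linfty_conj u2o; have v2c := Linfty_conj v2o.
have VL (f : cfun R) : Linfty f -> L2 (antiV (Pminus f)).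
  by move=> fo; exact/L2_V/L2_Q/L2_Linfty.
have QL (f : cfun R) : Linfty f -> L2 (Pminus f).
  by move=> fo; exact/L2_Q/L2_Linfty.
have tensE := tensor_equation_blocks (VL _ f1c) (VL _ u1c) (VL _ f2c) (VL _ u2c)
  (VL _ f2o) (VL _ g2o) (VL _ f1o) (VL _ g1o) (QL _ g1o) (QL _ v1o) (QL _ g2o)
  (QL _ v2o) (QL _ u2c) (QL _ v2c) (QL _ u1c) (QL _ v1c).
have eq1E := Hankel_equation_block f2c u2c v2c f1c u1c v1c.
have eq2E := Hankel_equation_block f1o g1o v1o f2o g2o v2o.
have D1 := block_diag_hardy f1o g1o u1o f2o g2o u2o.
have D2 := block_diag_hperp g1o u1o v1o g2o u2o v2o.
have K1 := hform4_coefV f2o f1c g2o u1c f1o f2c g1o u2c.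
have K2 := hform4_coefV g1o u2c v1o v2c g2o u1c v2o v1c.
(* The block from the complement of H^2 to H^2, rewritten through adjoints in the
   shape of the first operator equation. *)
have C12 : (forall c b, hperp c -> hardy b ->
      block u2 v2 f1 u1 c b = block u1 v1 f2 u2 c b) <->
    (forall b c, hardy b -> hperp c ->
      block (conjf f1) (conjf u1) (conjf u2) (conjf v2) b c =
      block (conjf f2) (conjf u2) (conjf u1) (conjf v1) b c).
  split=> e b c hb hc.
    have b2 := hardy_L2 hb; have c2 := hperp_L2 hc.
    apply: (etrans (block_conj u2o v2o f1o u1o b2 c2)).
    apply: etrans (esym (block_conj u1o v1o f2o u2o b2 c2)).
    exact: (f_equal conjc (e _ _ hc hb)).
  have b2 := hperp_L2 hb; have c2 := hardy_L2 hc.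
  have h1 := block_conj u2o v2o f1o u1o c2 b2.
  have h2 := block_conj u1o v1o f2o u2o c2 b2.
  have := e _ _ hc hb.
  move=> h; apply: (can_inj (@cconjK R)).
  exact: (etrans (esym h1) (etrans h h2)).
have VI (f y : cfun R) : Linfty f -> L2 y ->
    conjc (coefV f y) = inner (antiV (Pminus f)) y.
  by move=> fo y2; rewrite (innerC y2 (VL _ fo)).
have QI (f y : cfun R) : Linfty f -> L2 y ->
    conjc (inner f (Pminus y)) = inner y (Pminus f).
  move=> fo y2; have fL := L2_Linfty fo.
  by rewrite (innerC fL (L2_Q y2)) (innerQ_swap y2 fL).
split=> [/commE[c11 c12 c21 c22]|[e1 e2 t]].
  have b12 := C12.1 c12.
  split; [exact: eq1E.2 b12|exact: eq2E.2 c21|apply: tensE.2 => x y x2 y2].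
  have [Px Py] := (hardy_P x2, hardy_P y2); have [Qx Qy] := (hperp_Q x2, hperp_Q y2).
  have cP (f : cfun R) : Linfty f -> coefV f (Pplus x) = inner x (antiV (Pminus f)).
    by move=> fo; exact: coefV_P (L2_Linfty fo) x2.
  have ccP (f : cfun R) : Linfty f ->
      conjc (coefV f (Pplus y)) = inner (antiV (Pminus f)) y.
    by move=> fo; exact: conj_coefV_P (L2_Linfty fo) y2.
  have cQ (f : cfun R) : Linfty f ->
      coefV f (antiV (Pminus y)) = inner (Pminus f) y.
    by move=> fo; exact: coefV_VQ (L2_Linfty fo) y2.
  have ccQ (f : cfun R) : Linfty f ->
      conjc (coefV f (antiV (Pminus x))) = inner x (Pminus f).
    by move=> fo; exact: conj_coefV_VQ (L2_Linfty fo) x2.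
  have iQ (f : cfun R) : Linfty f -> inner f (Pminus y) = inner (Pminus f) y.
    by move=> fo; exact: esym (innerQ_swap (L2_Linfty fo) y2).
  split.
  - exact: (comb_congr (cP _ f2o) (ccP _ f1c) (cP _ g2o) (ccP _ u1c)
      (cP _ f1o) (ccP _ f2c) (cP _ g1o) (ccP _ u2c)
      (K1.1 (D1.1 c11) _ _ Px Py)).
  - have h := block_offdiag f2c u2c v2c f1c u1c v1c b12 Py Qx.
    exact: (comb_congr (QI _ _ u2c x2) (ccP _ f1c) (QI _ _ v2c x2) (ccP _ u1c)
      (QI _ _ u1c x2) (ccP _ f2c) (QI _ _ v1c x2) (ccP _ u2c)
      (comb_swap (comb_conj h))).
  - exact: (comb_congr (cP _ f2o) (iQ _ g1o) (cP _ g2o) (iQ _ v1o)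
      (cP _ f1o) (iQ _ g2o) (cP _ g1o) (iQ _ v2o)
      (block_offdiag f1o g1o v1o f2o g2o v2o c21 Px Qy)).
  - exact: (comb_congr (ccQ _ u2c) (cQ _ g1o) (ccQ _ v2c) (cQ _ v1o)
      (ccQ _ u1c) (cQ _ g2o) (ccQ _ v1c) (cQ _ v2o)
      (comb_swap (K2.1 (D2.1 c22) _ _ (hardy_V Qy) (hardy_V Qx)))).
have {}t := tensE.1 t.
apply: commE.2; split.
- apply: D1.2; apply: K1.2 => a b ha hb.
  have a2 := hardy_L2 ha; have b2 := hardy_L2 hb.
  have [t11 _ _ _] := t a b a2 b2.
  exact: (comb_congr erefl (esym (VI _ _ f1c b2)) erefl (esym (VI _ _ u1c b2))
    erefl (esym (VI _ _ f2c b2)) erefl (esym (VI _ _ u2c b2)) t11).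
- exact: C12.2 (eq1E.1 e1).
- exact: eq2E.1 e2.
apply: D2.2; apply: K2.2 => b a hb ha.
have a2 := hardy_L2 ha; have b2 := hardy_L2 hb.
have [_ _ _ t22] := t _ _ (L2_V a2) (L2_V b2).
have VA (f : cfun R) : Linfty f -> inner (antiV a) (Pminus f) = conjc (coefV f a).
  move=> fo; apply: etrans (esym (VI _ _ fo a2)); exact: inner_Vl.
have VB (f : cfun R) : Linfty f -> inner (Pminus f) (antiV b) = coefV f b.
  by move=> fo; exact: inner_Vr (QL _ fo) b2.
exact: (comb_swap (comb_congr (VA _ u2c) (VB _ g1o) (VA _ v2c) (VB _ v1o)
  (VA _ u1c) (VB _ g2o) (VA _ v1c) (VB _ v2o) t22)).
Qed.
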